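(* Let $m$ and $d$ be positive integers and let $H:\mathbb{R}^d\to\mathbb{R}^m$ be a function. Let $\varphi$ be a normal scale mixture, and let $G:\mathbb{R}^{2d}\to\mathbb{R}^{m\times m}$ be such that either $G$ is a cross variogram in $\mathbb{R}^d$ or $-G$ is a cross covariance function in $\mathbb{R}^d$. Let $M\in\mathbb{R}^{m\times m}$ be a positive definite matrix such that $M+G(x,y)$ is strictly positive definite for all $x,y\in\mathbb{R}^d$. Then $$C(x,y)=\frac{\varphi\left(\left[(H(x)-H(y))^\top (M+G(x,y))^{-1}(H(x)-H(y))\right]^{1/2}\right)}{\sqrt{|M+G(x,y)|}},\qquad x,y\in\mathbb{R}^d,$$ is a covariance function in $\mathbb{R}^d$.
   Context: Here $|A|$ denotes the determinant of a square matrix $A$. A Hermitian matrix $A\in\mathbb{C}^{m\times m}$ is called positive definite if $v^\top A\bar v\ge 0$ for all $v\in\mathbb{C}^m$, and strictly positive definite if $v^\top A\bar v>0$ for all $v\neq 0$. In particular (strictly) positive definite real matrices are symmetric. A normal scale mixture is a function $\varphi:[0,\infty)\to\mathbb{R}$ of the form $\varphi(h)=\int_{[0,\infty)}\exp(-ah^2)\,\mathrm{d}F(a)$, $h\ge0$, for some non-negative measure $F$ on $[0,\infty)$ (necessarily finite, since $\varphi(0)$ is a real number). Random fields: $Z(x)=(Z_1(x),\dots,Z_m(x))$, $x\in\mathbb{R}^d$, is a zero mean, second order, $m$-variate complex valued random field if $\mathrm{Var}\,Z_j(x)$ exists and $\mathbb{E}Z_j(x)=0$ for all $x$ and $j$.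 Its cross covariance function $C:\mathbb{R}^{2d}\to\mathbb{C}^{m\times m}$ is $C_{jk}(x,y)=\mathrm{Cov}(Z_j(x),Z_k(y))=\mathbb{E}Z_j(x)\overline{Z_k(y)}$. A function $C:\mathbb{R}^{2d}\to\mathbb{C}^{m\times m}$ is a cross covariance function in $\mathbb{R}^d$ if it is the cross covariance function of such a field; equivalently $C(x,y)=\overline{C^\top(y,x)}$ for all $x,y$ and $\sum_{p,q=1}^n a_p^\top C(x_p,x_q)\bar a_q\ge0$ for all $n\in\mathbb{N}$, $x_1,\dots,x_n\in\mathbb{R}^d$, $a_1,\dots,a_n\in\mathbb{C}^m$. For $m=1$ one says covariance function. The cross variogram $\gamma:\mathbb{R}^{2d}\to\mathbb{C}^{m\times m}$ of such a field $Z$ is $\gamma_{jk}(x,y)=\tfrac12\mathbb{E}\,(Z_j(x)-Z_j(y))\overline{(Z_k(x)-Z_k(y))}$. A function is a cross variogram in $\mathbb{R}^d$ if it is the cross variogram of some such $Z$. *)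

(* Defs.v *)
From HB Require Import structures.
From mathcomp Require Import all_boot all_order all_algebra.
From mathcomp Require Import complex.
From mathcomp Require Import all_classical all_reals all_analysis.

Set Implicit Arguments.
Unset Strict Implicit.
Unset Printing Implicit Defensive.

Import Order.TTheory GRing.Theory Num.Theory.
Import numFieldNormedType.Exports.

Local Open Scope ring_scope.
Local Open Scope complex_scope.
Local Open Scope classical_set_scope.

(* Points of R^d are column vectors ['cV[R]_d], functions on R^{2d} are
   curried, and [R[i]] is the field of complex numbers. *)

Definition cplx_mx (R : realType) (m n : nat) (A : 'M[R]_(m, n)) :
  'M[R[i]]_(m, n) := map_mx (real_complex R) A.

(* [v^T A v^bar]; the order of [R[i]] is such that [0 <= z] and [0 < z] entail
   that [z] is real. *)
Definition hermitian_form (R : realType) (m : nat) (A : 'M[R[i]]_m)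
    (v : 'cV[R[i]]_m) : R[i] :=
  (v^T *m A *m map_mx Num.conj v) 0 0.

Definition posdef (R : realType) (m : nat) (A : 'M[R[i]]_m) : Prop :=
  A \is hermsymmx /\ forall v : 'cV[R[i]]_m, 0 <= hermitian_form A v.

Definition strict_posdef (R : realType) (m : nat) (A : 'M[R[i]]_m) : Prop :=
  A \is hermsymmx /\
  forall v : 'cV[R[i]]_m, v != 0 -> 0 < hermitian_form A v.

(* [phi] is only constrained on [0, +oo[, and [F] only matters there.  The
   identity holds in the extended reals, so that (taking h = 0) [F] is
   finite on [0, +oo[. *)
Definition normal_scale_mixture (R : realType) (phi : R -> R) : Prop :=
  exists F : {measure set (measurableTypeR R) -> \bar R},
    forall h : R, 0 <= h ->
      (phi h)%:E = (\int[F]_(a in `[0%R, +oo[) (expR (- (a * h ^+ 2)))%:E)%E.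

(* Measurability for the Borel sigma-algebra of the complex plane. *)
Definition complex_rv (R : realType) (disp : measure_display)
    (T : measurableType disp) (X : T -> R[i]) : Prop :=
  measurable_fun setT (fun w => complex.Re (X w)) /\
  measurable_fun setT (fun w => complex.Im (X w)).

(* The usual expectation when [X] is integrable; [fine] returns 0 on infinite
   values. *)
Definition complex_expectation (R : realType) (disp : measure_display)
    (T : measurableType disp) (P : probability T R) (X : T -> R[i]) : R[i] :=
  fine ('E_P[fun w => complex.Re (X w)])%E +i*
  fine ('E_P[fun w => complex.Im (X w)])%E.

(* [Z x j] is the random variable Z_j(x).  As E|Z_j(x)|^2 is finite, all the
   expectations taken below are those of integrable random variables. *)
Definition second_order_field (R : realType) (disp : measure_display)
    (T : measurableType disp) (P : probability T R) (d m : nat)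
    (Z : 'cV[R]_d -> 'I_m -> T -> R[i]) : Prop :=
  forall (x : 'cV[R]_d) (j : 'I_m),
    [/\ complex_rv (Z x j),
        ('E_P[fun w => (Normc.normc (Z x j w) ^+ 2)%R] < +oo)%E &
        complex_expectation P (Z x j) = 0].

Definition field_cross_covariance (R : realType) (disp : measure_display)
    (T : measurableType disp) (P : probability T R) (d m : nat)
    (Z : 'cV[R]_d -> 'I_m -> T -> R[i]) (x y : 'cV[R]_d) : 'M[R[i]]_m :=
  \matrix_(j, k) complex_expectation P (fun w => Z x j w * (Z y k w)^*).

Definition field_cross_variogram (R : realType) (disp : measure_display)
    (T : measurableType disp) (P : probability T R) (d m : nat)
    (Z : 'cV[R]_d -> 'I_m -> T -> R[i]) (x y : 'cV[R]_d) : 'M[R[i]]_m :=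
  \matrix_(j, k) (2^-1 *
    complex_expectation P
      (fun w => (Z x j w - Z y j w) * (Z x k w - Z y k w)^*)).

Definition cross_covariance_function (R : realType) (d m : nat)
    (C : 'cV[R]_d -> 'cV[R]_d -> 'M[R[i]]_m) : Prop :=
  exists (disp : measure_display) (T : measurableType disp)
         (P : probability T R) (Z : 'cV[R]_d -> 'I_m -> T -> R[i]),
    second_order_field P Z /\
    forall x y : 'cV[R]_d, C x y = field_cross_covariance P Z x y.

Definition cross_variogram (R : realType) (d m : nat)
    (G : 'cV[R]_d -> 'cV[R]_d -> 'M[R[i]]_m) : Prop :=
  exists (disp : measure_display) (T : measurableType disp)
         (P : probability T R) (Z : 'cV[R]_d -> 'I_m -> T -> R[i]),
    second_order_field P Z /\
    forall x y : 'cV[R]_d, G x y = field_cross_variogram P Z x y.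

Definition covariance_function (R : realType) (d : nat)
    (C : 'cV[R]_d -> 'cV[R]_d -> R[i]) : Prop :=
  cross_covariance_function (fun x y => (C x y)%:M : 'M[R[i]]_1).

(* Main.v *)
Require Import Defs.
From HB Require Import structures.
From mathcomp Require Import all_boot all_order all_algebra.
From mathcomp Require Import complex.
From mathcomp Require Import all_classical all_reals all_analysis.
From mathcomp Require Import measurable_realfun interval_inference.
From mathcomp Require Import ring lra.

(** By the Gaussian Fourier formula, for [S] positive definite and [b] real,
    [exp(-b^2 h^T S^-1 h) / sqrt |S|] is up to a constant the integral over
    [u] in [R^m] of [exp(-u^T S u) cos(2 b u^T h)].  Take [S = M + G(x,y)],
    [h = H x - H y], and mix over [b].  For fixed [u], if [G] is the cross
    variogram of [Z] then [- u^T G(x,y) u] is a covariance (that of [u^T Z], up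
    to taking real parts) minus a function of [x] and a function of [y]; if
    [- G] is a cross covariance function, it is a covariance.  Hence
    [exp(-u^T S u) = rho_u(x) rho_u(y) exp(K_u(x,y))] with [K_u] a
    covariance, and [cos(2 b u^T h)] is a sum of two products of
    a function of [x] and the same function of [y].

    A covariance function must be realised by an actual random field.  We never
    need Kolmogorov's extension theorem: kernels that are Gram matrices in some
    [L^2(Q)], [Q] a probability, are stable under sums, products, convergent
    series (hence exponentials) and integration over a parameter, by
    taking disjoint unions and products of probability spaces; multiplying by
    an independent random sign finally centres the field. *)

Import Order.TTheory GRing.Theory Num.Theory.
Import numFieldNormedType.Exports.
Set Implicit Arguments.
Unset Strict Implicit.
Unset Printing Implicit Defensive.
Local Open Scope ring_scope.
Local Open Scope classical_set_scope.

(** * Gram kernels in L^2 of a probability space *)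

Section product_integrals.
Context {R : realType}.

Lemma integrable_of_integral_ge0 d (T : measurableType d)
    (mu : {measure set T -> \bar R}) (f : T -> R) (c : R) :
  measurable_fun setT f -> (forall t, 0 <= f t) ->
  (\int[mu]_t (f t)%:E)%E = c%:E -> mu.-integrable setT (EFin \o f).
Proof.
move=> mf f0 fc; apply/integrableP; split; first exact/measurable_EFinP.
under eq_integral do rewrite /= ger0_norm//.
by rewrite fc ltry.
Qed.

Lemma le_integrableR d (T : measurableType d)
    (mu : {measure set T -> \bar R}) (f g : T -> R) :
  measurable_fun setT f -> (forall t, `|f t| <= g t) ->
  mu.-integrable setT (EFin \o g) -> mu.-integrable setT (EFin \o f).
Proof.
move=> mf fg; apply: le_integrable => //; first exact/measurable_EFinP.
by move=> t _ /=; rewrite lee_fin (le_trans (fg t))// ler_norm.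
Qed.

(** Tonelli for the majorant [g] makes [f] integrable on the product, and then Fubini applies. Later
    product integrals all take this form: exhibit a majorant with explicit iterated integral, then
    compute the inner integral of [f] pointwise. *)
Lemma integral_prod_dominated d1 d2 (T1 : measurableType d1)
    (T2 : measurableType d2) (m1 : probability T1 R) (m2 : probability T2 R)
    (f g : T1 * T2 -> R) (F G : T1 -> R) (c : R) :
  measurable_fun setT f -> measurable_fun setT g ->
  (forall z, `|f z| <= g z) ->
  (forall x, (\int[m2]_y (g (x, y))%:E)%E = (G x)%:E) ->
  (\int[m1]_x (G x)%:E)%E = c%:E ->
  (forall x, (\int[m2]_y (f (x, y))%:E)%E = (F x)%:E) ->
  (\int[m1 \x m2]_z (f z)%:E)%E = (\int[m1]_x (F x)%:E)%E.
Proof.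
move=> mf mg fg gG Gc fF.
have mgE : measurable_fun setT (EFin \o g) by exact/measurable_EFinP.
have ig : (m1 \x m2)%E.-integrable setT (EFin \o g).
  apply: (@integrable_of_integral_ge0 _ _ _ _ c) => //.
    by move=> z; rewrite (le_trans _ (fg z)).
  rewrite (fubini_tonelli1 _ mgE)//; last first.
    by move=> z /=; rewrite lee_fin (le_trans _ (fg z)).
  by rewrite -Gc; apply: eq_integral => x _; rewrite -gG.
have if_ := le_integrableR mf fg ig.
rewrite -(integral12_prod_meas1 if_).
by apply: eq_integral => x _; rewrite -fF.
Qed.

End product_integrals.

Section gram_families.
Context {R : realType}.

Lemma normr_mul_le_sqr (a b : R) : `|a * b| <= a ^+ 2 + b ^+ 2.
Proof.
rewrite normrM -[a ^+ 2]real_normK ?num_real// -[b ^+ 2]real_normK ?num_real//.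
have : 0 <= (`|a| - `|b|) ^+ 2 by exact: sqr_ge0.
have : 0 <= `|a| * `|b| by exact: mulr_ge0.
by nra.
Qed.

Lemma integrable_sqr d (T : measurableType d) (mu : {measure set T -> \bar R})
    (f : T -> R) (a : R) : measurable_fun setT f ->
  (\int[mu]_t (f t * f t)%:E)%E = a%:E ->
  mu.-integrable setT (fun t => (f t * f t)%:E).
Proof.
move=> mf; apply: (@integrable_of_integral_ge0 _ _ _ _ (fun t => f t * f t) a).
  exact: measurable_funM.
by move=> t; rewrite -expr2 sqr_ge0.
Qed.

Section square_integrable.
Context d (T : measurableType d) (mu : {measure set T -> \bar R}).
Variables (f g : T -> R) (a b : R).
Hypotheses (mf : measurable_fun setT f) (mg : measurable_fun setT g).
Hypotheses (fa : (\int[mu]_t (f t * f t)%:E)%E = a%:E).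
Hypotheses (gb : (\int[mu]_t (g t * g t)%:E)%E = b%:E).

Lemma integrableM2 : mu.-integrable setT (fun t => (f t * g t)%:E).
Proof.
apply: (@le_integrableR _ _ _ _ (fun t => f t * g t)
  (fun t => f t * f t + g t * g t)).
- exact: measurable_funM.
- by move=> t; rewrite -!expr2 normr_mul_le_sqr.
- have := integrableD measurableT (integrable_sqr mf fa) (integrable_sqr mg gb).
  by apply: eq_integrable => // t _ /=; rewrite EFinD.
Qed.

Lemma integral_sum_sqr :
  (\int[mu]_t (f t * f t + g t * g t)%:E)%E = (a + b)%:E.
Proof.
under eq_integral do rewrite EFinD.
rewrite integralD//= ?fa ?gb//; [exact: integrable_sqr fa|exact: integrable_sqr gb].
Qed.

(* Polarization: a Gram matrix is determined by the integrals of squares,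
   which are nonnegative functions. *)
Lemma integral_sqrD c : (\int[mu]_t (f t * g t)%:E)%E = c%:E <->
  (\int[mu]_t ((f t + g t) * (f t + g t))%:E)%E = (a + b + c *+ 2)%:E.
Proof.
have ifg := integrableM2.
have isq : mu.-integrable setT (fun t => (f t * f t + g t * g t)%:E).
  have := integrableD measurableT (integrable_sqr mf fa) (integrable_sqr mg gb).
  by apply: eq_integrable => // t _ /=; rewrite EFinD.
have -> : (\int[mu]_t ((f t + g t) * (f t + g t))%:E =
   (a + b)%:E + 2%:E * \int[mu]_t (f t * g t)%:E)%E.
  rewrite -integralZl// -integral_sum_sqr -integralD//=; last first.
    exact: integrableZl.
  by apply: eq_integral => t _; rewrite -EFinM -EFinD; congr EFin; ring.
have /fineK <- := integrable_fin_num measurableT ifg.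
rewrite -!EFinM -!EFinD; split=> [[->]|[]]; first by rewrite mulr_natl.
by move=> h; congr EFin; lra.
Qed.

End square_integrable.

(* Joint measurability of [f x] in the parameter [u] and the sample point [v] is
   what allows [u] to become part of the sample point later on. *)
Definition gram_family d (U : measurableType d) (X : Type)
    (k : U -> X -> X -> R) : Prop :=
  exists d' (V : measurableType d') (Q : probability V R) (f : X -> U * V -> R),
    (forall x, measurable_fun setT (f x)) /\
    forall u x y, (\int[Q]_v (f x (u, v) * f y (u, v))%:E)%E = (k u x y)%:E.

Context d (U : measurableType d) (X : Type).
Implicit Types k : U -> X -> X -> R.

Lemma eq_gram_family k1 k2 : (forall u x y, k1 u x y = k2 u x y) ->
  gram_family k1 -> gram_family k2.
Proof.
move=> k12 [d' [V [Q [f [mf fk]]]]]; exists d', V, Q, f; split=> // u x y.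
by rewrite fk k12.
Qed.

(** A one-point sample space suffices: for fixed [u] the kernel has rank one. *)
Lemma gram_family_rank1 (g : X -> U -> R) :
  (forall x, measurable_fun setT (g x)) ->
  gram_family (fun u x y => g x u * g y u).
Proof.
move=> mg; exists _, unit, (\d_ tt : probability unit R), (fun x uv => g x uv.1).
split=> [x|u x y]; first exact: measurableT_comp.
by rewrite integral_dirac//= diracT mul1e.
Qed.

(** Schur product: on the product of the two sample spaces the factors are independent, so the
    integral of their product splits. *)
Lemma gram_family_mul k1 k2 : gram_family k1 -> gram_family k2 ->
  gram_family (fun u x y => k1 u x y * k2 u x y).
Proof.
move=> [d1 [V1 [Q1 [f1 [mf1 fk1]]]]] [d2 [V2 [Q2 [f2 [mf2 fk2]]]]].
exists _, (V1 * V2)%type, (Q1 \x Q2)%E,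
  (fun x uv => f1 x (uv.1, uv.2.1) * f2 x (uv.1, uv.2.2)).
have m1 x u : measurable_fun setT (fun v => f1 x (u, v)).
  by apply: measurableT_comp => //; exact: pair1_measurable.
have m2 x u : measurable_fun setT (fun v => f2 x (u, v)).
  by apply: measurableT_comp => //; exact: pair1_measurable.
split=> [x|u x y].
  apply: measurable_funM.
    apply: measurableT_comp (mf1 x) _.
    by apply: measurable_fun_pair => //; exact: measurableT_comp.
  apply: measurableT_comp (mf2 x) _.
  by apply: measurable_fun_pair => //; exact: measurableT_comp.
(* Each [F] dominates the product of the values at [x] and [y], so [F1 * F2] is the majorant for
   Fubini. *)
pose F1 v := f1 x (u, v) * f1 x (u, v) + f1 y (u, v) * f1 y (u, v).
pose F2 v := f2 x (u, v) * f2 x (u, v) + f2 y (u, v) * f2 y (u, v).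
have F1_ge0 v : 0 <= F1 v by rewrite /F1 -!expr2 addr_ge0 ?sqr_ge0.
have F2_ge0 v : 0 <= F2 v by rewrite /F2 -!expr2 addr_ge0 ?sqr_ge0.
have mF1 : measurable_fun setT F1.
  by apply: measurable_funD; apply: measurable_funM.
have mF2 : measurable_fun setT F2.
  by apply: measurable_funD; apply: measurable_funM.
have IF1 := integral_sum_sqr (m1 x u) (m1 y u) (fk1 u x x) (fk1 u y y).
have IF2 := integral_sum_sqr (m2 x u) (m2 y u) (fk2 u x x) (fk2 u y y).
have iF1 := integrable_of_integral_ge0 mF1 F1_ge0 IF1.
have iF2 := integrable_of_integral_ge0 mF2 F2_ge0 IF2.
rewrite (@integral_prod_dominated _ _ _ _ _ _ _ _
   (fun z => F1 z.1 * F2 z.2)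
   (fun v => f1 x (u, v) * f1 y (u, v) * k2 u x y)
   (fun v => F1 v * (k2 u x x + k2 u y y))
   ((k1 u x x + k1 u y y) * (k2 u x x + k2 u y y))) //=.
- under eq_integral do rewrite EFinM.
  rewrite integralZr//=; last exact: integrableM2 (fk1 u x x) (fk1 u y y).
  by rewrite fk1.
- by apply: measurable_funM; apply: measurable_funM;
    (apply: measurableT_comp (m1 _ _) _ || apply: measurableT_comp (m2 _ _) _).
- by apply: measurable_funM; (apply: measurableT_comp mF1 _ ||
     apply: measurableT_comp mF2 _).
- move=> [v1 v2] /=; rewrite mulrACA normrM.
  by apply: ler_pM => //; rewrite /F1 /F2 -!expr2 normr_mul_le_sqr.
- move=> v; under eq_integral do rewrite EFinM.
  by rewrite integralZl//= IF2.
- under eq_integral do rewrite EFinM.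
  by rewrite integralZr//= IF1.
- move=> v1.
  under eq_integral do rewrite mulrACA EFinM.
  rewrite integralZl//=; last exact: integrableM2 (fk2 u x x) (fk2 u y y).
  by rewrite fk2.
Qed.

Lemma gram_family_scale k (c : R) : 0 <= c -> gram_family k ->
  gram_family (fun u x y => c * k u x y).
Proof.
move=> c0 gk.
have := gram_family_mul (@gram_family_rank1 (fun _ _ => Num.sqrt c) _) gk.
move/(_ (fun _ => measurable_cst _)); apply: eq_gram_family => u x y.
by rewrite -expr2 sqr_sqrtr.
Qed.

Lemma gram_family_exp_n k n : gram_family k ->
  gram_family (fun u x y => k u x y ^+ n).
Proof.
move=> gk; elim: n => [|n IH].
  have := @gram_family_rank1 (fun _ _ => 1) (fun _ => measurable_cst _).
  by apply: eq_gram_family => u x y; rewrite expr0 mulr1.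
apply: eq_gram_family (gram_family_mul gk IH) => u x y.
by rewrite exprS.
Qed.

(** The parameter [u], drawn according to [P], becomes a coordinate of the sample point; the trivial
    parameter [unit] remains. *)
Lemma gram_family_integral (P : probability U R) k (K : X -> X -> R) :
  gram_family k ->
  (forall x y, (\int[P]_u (k u x y)%:E)%E = (K x y)%:E) ->
  gram_family (fun (_ : unit) x y => K x y).
Proof.
move=> [d' [V [Q [f [mf fk]]]]] kK.
exists _, (U * V)%type, (P \x Q)%E, (fun x uv => f x uv.2).
split=> [x|u0 x y]; first exact: measurableT_comp.
have mf2 x' u : measurable_fun setT (fun v => f x' (u, v)).
  by apply: measurableT_comp => //; exact: pair1_measurable.
(* [gram_family] does not state that [k] is measurable in [u]; on the diagonal this follows from
   Tonelli, the integrand being a square. *)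
have mk x' : measurable_fun setT (fun u => k u x' x').
  apply/measurable_EFinP.
  rewrite (_ : _ \o _ = fun u => \int[Q]_v (f x' (u, v) * f x' (u, v))%:E)%E.
    apply: (measurable_fun_fubini_tonelli_F
      (fun z => (f x' z * f x' z)%:E)) => //.
      by apply/measurable_EFinP; exact: measurable_funM.
    by move=> z; rewrite lee_fin -expr2 sqr_ge0.
  by apply/funext => u /=; rewrite fk.
have k_ge0 u x' : 0 <= k u x' x'.
  rewrite -lee_fin -fk; apply: integral_ge0 => v _.
  by rewrite lee_fin -expr2 sqr_ge0.
have ik x' : P.-integrable setT (fun u => (k u x' x')%:E).
  by apply: (@integrable_of_integral_ge0 _ _ _ _ (fun u => k u x' x') (K x' x')).
rewrite (@integral_prod_dominated _ _ _ _ _ _ _ _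
   (fun z => f x z * f x z + f y z * f y z)
   (fun u => k u x y) (fun u => k u x x + k u y y) (K x x + K y y)) //=.
- exact: measurable_funM.
- by apply: measurable_funD; apply: measurable_funM.
- by move=> z; rewrite -!expr2; case: z => ? ?; rewrite normr_mul_le_sqr.
- by move=> u; rewrite (integral_sum_sqr (mf2 x u) (mf2 y u) (fk u x x) (fk u y y)).
- under eq_integral do rewrite EFinD.
  by rewrite integralD//= !kK.
Qed.

End gram_families.

(** * Countable disjoint unions of measurable spaces and of probabilities *)

Section countable_sum_space.
Context (d : nat -> measure_display) (V : forall n, measurableType (d n)).

Definition sum_space : Type := {n : nat & V n}.

HB.instance Definition _ := Choice.on sum_space.
HB.instance Definition _ := isPointed.Build sum_space (existT _ 0%N (point : V 0%N)).

(** The largest sigma-algebra for which all injections of the components are measurable. *)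
Definition sum_measurable (A : set sum_space) : Prop :=
  forall n, measurable [set v : V n | A (existT _ n v)].

Let sum_measurable0 : sum_measurable set0.
Proof. by move=> n; exact: measurable0. Qed.

Let sum_measurableC A : sum_measurable A -> sum_measurable (~` A).
Proof. by move=> mA n; exact: measurableC (mA n). Qed.

Let sum_measurable_bigcup (F : (set sum_space)^nat) :
  (forall i, sum_measurable (F i)) -> sum_measurable (\bigcup_i F i).
Proof.
move=> mF n; rewrite (_ : [set v | _] =
  \bigcup_i [set v : V n | F i (existT _ n v)]); last first.
  by apply/seteqP; split=> v [i ? ?]; exists i.
by apply: bigcupT_measurable => i; exact: mF.
Qed.

HB.instance Definition _ := isMeasurable.Build default_measure_display
  sum_space sum_measurable0 sum_measurableC sum_measurable_bigcup.

Definition sum_inj n (v : V n) : sum_space := existT _ n v.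

Lemma measurable_sum_inj n : measurable_fun setT (@sum_inj n).
Proof. by move=> _ A mA; rewrite setTI; exact: mA. Qed.

(** A total left inverse of [sum_inj]: points of the other components go to the default [point]. *)
Definition sum_proj n (w : sum_space) : V n :=
  tagged_as (existT (fun n => V n) n (point : V n)) w.

Lemma sum_proj_inj n v : sum_proj n (sum_inj v) = v.
Proof. by rewrite /sum_proj tagged_asE. Qed.

(** The map is the identity on component [n] and constant on the others, where a preimage is
    everything or nothing. *)
Lemma measurable_sum_proj n : measurable_fun setT (sum_proj n).
Proof.
move=> _ A mA; rewrite setTI; change (sum_measurable (sum_proj n @^-1` A)) => m.
have [<-|nm] := eqVneq n m.
  rewrite (_ : [set v | _] = A)//.
  by apply/seteqP; split=> v /=; rewrite -/(sum_inj v) sum_proj_inj.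
have pn v : sum_proj n (@sum_inj m v) = point.
  by rewrite /sum_proj /tagged_as /=; case: eqP nm => // ->; rewrite eqxx.
have [Ap|nAp] := pselect (A point).
  rewrite (_ : [set v | _] = setT)//.
  by apply/seteqP; split=> v //= _; rewrite -/(sum_inj v) pn.
rewrite (_ : [set v | _] = set0)//.
by apply/seteqP; split=> v //=; rewrite -/(sum_inj v) pn.
Qed.

Lemma measurable_sum_tag n : measurable [set w : sum_space | tag w = n].
Proof.
change (sum_measurable [set w : sum_space | tag w = n]) => m.
have [<-|nm] := eqVneq n m.
  by rewrite (_ : [set v | _] = setT)//; apply/seteqP; split.
rewrite (_ : [set v | _] = set0)//; apply/seteqP; split=> v //= /eqP.
by rewrite eq_sym (negbTE nm).
Qed.

(** The space is cut into countably many pieces according to the tag. On the piece of tag [n] the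
    dependently typed [tagged] agrees with [sum_proj n], which has the fixed target [V n]. *)
Lemma measurable_sum_pair dU (U : measurableType dU) dT (T : measurableType dT)
    (f : forall n, U * V n -> T) :
  (forall n, measurable_fun setT (f n)) ->
  measurable_fun setT
    (fun uw : U * sum_space => f (tag uw.2) (uw.1, tagged uw.2)).
Proof.
move=> mf _ A mA; rewrite setTI.
rewrite (_ : _ @^-1` _ = \bigcup_n ([set uw : U * sum_space | tag uw.2 = n] `&`
  (fun uw => f n (uw.1, sum_proj n uw.2)) @^-1` A)); last first.
  apply/seteqP; split=> [[u [n v]] /= Av|[u [m v]] [n _ [/= <-]]].
    exists n => //; split=> //=.
    by rewrite -/(sum_inj v) sum_proj_inj.
  by rewrite -/(sum_inj v) sum_proj_inj.
apply: bigcupT_measurable => n; apply: measurableI.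
  rewrite (_ : [set _ | _] = setT `*` [set w : sum_space | tag w = n]).
    by apply: measurableX => //; exact: measurable_sum_tag.
  by apply/seteqP; split=> [z /= ->|z /= []].
rewrite -[X in measurable X]setTI.
have /(_ measurableT _ mA) : measurable_fun setT
  (fun uw : U * sum_space => f n (uw.1, sum_proj n uw.2)); last exact.
apply: measurableT_comp (mf n) _; apply: measurable_fun_pair => //.
by apply: measurableT_comp; first exact: measurable_sum_proj.
Qed.

End countable_sum_space.

Lemma nneseries_EFin {R : realType} (a : nat -> R) (l : R) :
  series a @ \oo --> l -> (\sum_(0 <= n <oo) (a n)%:E)%E = l%:E.
Proof.
move=> al; apply: cvg_lim => //.
apply: cvg_EFin; first by apply: nearW => n; rewrite sumEFin.
by rewrite (_ : _ \o _ = series a)//; apply/funext => n /=; rewrite sumEFin.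
Qed.

Section sum_probability.
Context {R : realType} (d : nat -> measure_display).
Context (V : forall n, measurableType (d n)).
Variable Q : forall n, probability (V n) R.

(** Positive weights of total mass 1, written in the shape of the geometric series that
    [sum_prob_setT] sums. *)
Definition half_weight (n : nat) : R := 1 / (2 ^ (n + 1))%:R.

Lemma half_weight_gt0 n : 0 < half_weight n.
Proof. by rewrite /half_weight div1r invr_gt0 ltr0n expn_gt0. Qed.

Let p n : {nonneg R} := NngNum (ltW (half_weight_gt0 n)).

Let push n : {measure set (sum_space V) -> \bar R} :=
  measure_function_pushforward__canonical__measure_function_Measure
    (Q n) (@measurable_sum_inj _ V n).

(** The mixture that draws [n] with probability [half_weight n], then a point of [V n] according to
    [Q n]. *)
Definition sum_prob : set (sum_space V) -> \bar R :=
  mseries (fun n => mscale (p n) (push n)) 0.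

HB.instance Definition _ := Measure.on sum_prob.

Lemma integral_sum_prob (g : sum_space V -> R) :
  measurable_fun setT g -> (forall w, 0 <= g w) ->
  (\int[sum_prob]_w (g w)%:E = \sum_(0 <= n <oo)
     (half_weight n)%:E * \int[Q n]_v (g (sum_inj v))%:E)%E.
Proof.
move=> mg g0.
have mgE : measurable_fun setT (EFin \o g) by exact/measurable_EFinP.
have gE0 w : (0 <= (EFin \o g) w)%E by rewrite lee_fin.
rewrite (ge0_integral_measure_series _ measurableT _ mgE)//.
apply: eq_eseriesr => n _; rewrite ge0_integral_mscale//; congr (_ * _)%E.
exact: (ge0_integral_pushforward (@measurable_sum_inj _ V n)).
Qed.

Let sum_prob_setT : sum_prob setT = 1%E.
Proof.
transitivity (\int[sum_prob]_w 1%:E)%E; first by rewrite integral_cst// mul1e.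
rewrite (integral_sum_prob (g := fun=> 1))//.
under eq_eseriesr do rewrite integral_cst//= probability_setT !mule1.
have := @cvg_geometric_eseries_half R 1 0; rewrite expr0 divr1 => h.
exact: (cvg_lim _ h).
Qed.

HB.instance Definition _ :=
  Measure_isProbability.Build _ _ _ sum_prob sum_prob_setT.

End sum_probability.

(** * Series and exponentials of Gram kernels *)

Section gram_series.
Context {R : realType} dU (U : measurableType dU) (X : Type).

(** On the disjoint union of the sample spaces, the functions of component [n] are rescaled to
    cancel its weight, so that the integrals add up to the series. *)
Lemma gram_family_series (k : nat -> U -> X -> X -> R) (K : U -> X -> X -> R) :
  (forall n, gram_family (k n)) ->
  (forall u x y, series (fun n => k n u x y) @ \oo --> K u x y) ->
  gram_family K.
Proof.
move=> gk kK.
(* A witness is chosen for every [n]; space, probability and functions all depend on [n], hence the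
   nested dependent pairs. *)
have D n : {d : measure_display & {V : measurableType d &
    {Q : probability V R & {f : X -> U * V -> R |
      (forall x, measurable_fun setT (f x)) /\ forall u x y,
      (\int[Q]_v (f x (u, v) * f y (u, v))%:E)%E = (k n u x y)%:E}}}}.
  by have [d /cid[V /cid[Q /cid[f fP]]]] := cid (gk n); exists d, V, Q, f.
pose d n := projT1 (D n).
pose V n : measurableType (d n) := projT1 (projT2 (D n)).
pose Q n : probability (V n) R := projT1 (projT2 (projT2 (D n))).
pose f n : X -> U * V n -> R := sval (projT2 (projT2 (projT2 (D n)))).
have mf n x : measurable_fun setT (f n x).
  exact: (svalP (projT2 (projT2 (projT2 (D n))))).1.
have fk n u x y :
    (\int[Q n]_v (f n x (u, v) * f n y (u, v))%:E)%E = (k n u x y)%:E.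
  exact: (svalP (projT2 (projT2 (projT2 (D n))))).2.
clearbody d V Q f.
(* The factor occurs twice in a product of two functions, hence the square root. *)
pose c n : R := Num.sqrt (half_weight n)^-1.
have cc n : c n * c n = (half_weight n)^-1.
  by rewrite -expr2 sqr_sqrtr// invr_ge0 ltW// half_weight_gt0.
have mfn n x u : measurable_fun setT (fun v => f n x (u, v)).
  by apply: measurableT_comp => //; exact: pair1_measurable.
pose F x (uw : U * sum_space V) :=
  c (tag uw.2) * f (tag uw.2) x (uw.1, tagged uw.2).
have mF x : measurable_fun setT (F x).
  apply: (@measurable_sum_pair _ V _ U _ _ (fun n uv => c n * f n x uv)) => n.
  exact: measurable_funM.
exists _, (sum_space V), (sum_prob Q), F; split=> // u x y.
have mFu x' : measurable_fun setT (fun w => F x' (u, w)).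
  by apply: measurableT_comp => //; exact: pair1_measurable.
have weighted a n : ((half_weight n)%:E * ((half_weight n)^-1 * a)%:E = a%:E :> \bar R)%E.
  by rewrite -EFinM mulrA divff ?mul1r// gt_eqF// half_weight_gt0.
have Fsq x' : (\int[sum_prob Q]_w (F x' (u, w) * F x' (u, w))%:E)%E = (K u x' x')%:E.
  rewrite (integral_sum_prob Q (g := fun w => F x' (u, w) * F x' (u, w))).
  - rewrite -(nneseries_EFin (kK u x' x')); apply: eq_eseriesr => n _.
    rewrite -(weighted (k n u x' x') n); congr (_ * _)%E.
    under eq_integral do rewrite /F /= mulrACA cc EFinM.
    rewrite integralZl//= ?fk//.
    exact: (integrableM2 _ _ (fk n u x' x') (fk n u x' x')).
  - exact: measurable_funM.
  - by move=> w; rewrite -expr2 sqr_ge0.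
(* By polarization only nonnegative functions have to be integrated over the union, as
   [integral_sum_prob] demands. *)
apply/(integral_sqrD (mFu x) (mFu y) (Fsq x) (Fsq y)).
rewrite (integral_sum_prob Q
  (g := fun w => (F x (u, w) + F y (u, w)) * (F x (u, w) + F y (u, w)))).
- have kK2 : series (fun n => k n u x x + k n u y y + k n u x y *+ 2) @ \oo -->
      K u x x + K u y y + K u x y *+ 2.
    rewrite (_ : series _ = fun n => series (fun n => k n u x x) n +
        series (fun n => k n u y y) n + series (fun n => k n u x y) n *+ 2).
      by apply: cvgD; [apply: cvgD; exact: kK|apply: cvgMn; exact: kK].
    by apply/funext => n; rewrite /series /= 2!big_split/= sumrMnl.
  rewrite -(nneseries_EFin kK2); apply: eq_eseriesr => n _.
  rewrite -(weighted (k n u x x + k n u y y + k n u x y *+ 2) n); congr (_ * _)%E.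
  under eq_integral do rewrite /F /= -mulrDr mulrACA cc EFinM.
  have E := (integral_sqrD (mfn n x u) (mfn n y u) (fk n u x x)
    (fk n u y y) (k n u x y)).1 (fk n u x y).
  rewrite integralZl//= ?E//.
  apply: (@integrable_sqr _ _ _ _ _ _ _ E); exact: measurable_funD.
- by apply: measurable_funM; apply: measurable_funD.
- by move=> w; rewrite -expr2 sqr_ge0.
Qed.

(** Treated as the series [k1 + k2 + 0 + 0 + ...], whose partial sums are constant from index 2
    on. *)
Lemma gram_family_add (k1 k2 : U -> X -> X -> R) :
  gram_family k1 -> gram_family k2 ->
  gram_family (fun u x y => k1 u x y + k2 u x y).
Proof.
move=> g1 g2.
have g0 : gram_family (fun (_ : U) (_ _ : X) => 0 : R).
  apply: eq_gram_family (@gram_family_rank1 _ _ U X (fun _ _ => 0) _) => //.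
  by move=> *; rewrite mulr0.
apply: (@gram_family_series (fun n => if n is 0 then k1 else
   if n is 1 then k2 else fun _ _ _ => 0)); first by case=> [|[|n]].
move=> u x y; apply: cvg_near_cst; exists 2 => //= n /= n2.
rewrite /series/= -(subnKC n2) !big_nat_recl//= !big_mkord addrA.
by rewrite big1 ?addr0// => i _.
Qed.

(** The exponential series has nonnegative coefficients and powers of Gram kernels are Gram
    kernels. *)
Lemma gram_family_expR (k : U -> X -> X -> R) :
  gram_family k -> gram_family (fun u x y => expR (k u x y)).
Proof.
move=> gk; apply: (@gram_family_series
  (fun n u x y => (n`!%:R)^-1 * k u x y ^+ n)) => [n|u x y].
  by apply: gram_family_scale; [rewrite invr_ge0|exact: gram_family_exp_n].
have := is_cvg_series_exp_coeff (k u x y).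
rewrite (_ : series _ = series (exp_coeff (k u x y)))//.
by congr series; apply/funext => n; rewrite /exp_coeff /= mulrC.
Qed.

End gram_series.

(** * From Gram kernels to random fields *)

Section covariance_of_gram.
Context {R : realType}.

Let half01 : 0 <= (2^-1 : R) <= 1.
Proof. by apply/andP; split; lra. Qed.

Lemma integral_fair_coin (h : bool -> R) :
  (\int[bernoulli_prob 2^-1]_b (h b)%:E)%E = ((h true + h false) / 2)%:E.
Proof.
have ih (g : bool -> R) :
    (bernoulli_prob (2^-1 : R)).-integrable setT (fun b => (g b)%:E).
  apply: (@le_integrableR _ _ _ _ g (cst (`|g true| + `|g false|))) => //.
    by case=> /=; rewrite (lerDl, lerDr).
  exact: finite_measure_integrable_cst.
(* [integral_bernoulli_prob] is applied to a nonnegative function, so [h] is first shifted up by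
   [c]. *)
pose c := `|h true| + `|h false|.
have hc b : 0 <= h b + c.
  have := ler_norm (- h true); have := ler_norm (- h false); rewrite !normrN /c.
  have := normr_ge0 (h true); have := normr_ge0 (h false).
  by case: b; lra.
have -> : (\int[bernoulli_prob 2^-1]_b (h b)%:E =
    \int[bernoulli_prob 2^-1]_b (h b + c)%:E - c%:E)%E.
  under [X in _ = (X - _)%E]eq_integral do rewrite EFinD.
  rewrite integralD//= ?integral_cst//= ?probability_setT ?mule1.
  by rewrite addeK.
have hcE b : (0 <= (h b + c)%:E)%E by rewrite lee_fin.
rewrite (integral_bernoulli_prob half01 hcE).
rewrite -!EFinM -!EFinD; congr EFin; rewrite /unstable.onem; lra.
Qed.

(** The field is [f x] times an independent fair sign [s]: the sign makes the mean vanish, and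
    [s ^ 2 = 1] leaves the second moments unchanged. *)
Lemma covariance_function_of_gram d (K : 'cV[R]_d -> 'cV[R]_d -> R) :
  gram_family (fun (_ : unit) x y => K x y) ->
  covariance_function (fun x y => (K x y)%:C%C).
Proof.
move=> [d' [V [Q [F [mF FK]]]]].
pose f x v := F x (tt, v).
have mf x : measurable_fun setT (f x).
  by apply: measurableT_comp => //; exact: pair1_measurable.
have fK x y : (\int[Q]_v (f x v * f y v)%:E)%E = (K x y)%:E by exact: FK.
pose s (b : bool) : R := if b then 1 else -1.
have ss b : s b * s b = 1 by case: b; rewrite /s ?mulrNN mulr1.
pose Z (x : 'cV[R]_d) (_ : 'I_1) (w : V * bool) : R[i] := (f x w.1 * s w.2)%:C%C.
have mZ x : measurable_fun setT (fun w : V * bool => f x w.1 * s w.2).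
  apply: measurable_funM; first exact: measurableT_comp.
  by apply: (measurableT_comp (f := s)).
have PE x y : (\int[Q \x bernoulli_prob 2^-1]_w
    (f x w.1 * s w.2 * (f y w.1 * s w.2))%:E)%E = (K x y)%:E.
  rewrite (@integral_prod_dominated _ _ _ _ _ _ _ _
    (fun w => f x w.1 * f x w.1 + f y w.1 * f y w.1) (fun v => f x v * f y v)
    (fun v => f x v * f x v + f y v * f y v) (K x x + K y y)) //=.
  - exact: measurable_funM.
  - apply: measurable_funD; apply: measurable_funM;
      exact: (measurableT_comp (mf _)).
  - by move=> w; rewrite mulrACA ss mulr1 -!expr2 normr_mul_le_sqr.
  - by move=> v; rewrite integral_cst//= probability_setT mule1.
  - exact: (integral_sum_sqr (mf x) (mf y) (fK x x) (fK y y)).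
  - move=> v; rewrite integral_fair_coin; congr EFin.
    by rewrite [X in X + _]mulrACA [X in _ + X]mulrACA !ss; lra.
exists _, (V * bool)%type, (Q \x bernoulli_prob 2^-1)%E, Z; split.
  move=> x j; split.
  - by split => /=; [exact: mZ|exact: measurable_cst].
  - rewrite unlock (_ : integral _ _ _ = (K x x)%:E) ?ltry// -PE.
    apply: eq_integral => w _; congr EFin.
    by rewrite /Z /Normc.normc /= expr0n /= addr0 sqrtr_sqr real_normK ?num_real.
  (* For fixed [v] the two signs cancel, so the inner integral is 0; [f ^ 2 + 1] is the majorant, 1
     being the square of the sign. *)
  - rewrite /complex_expectation !unlock /= integral0.
    rewrite (@integral_prod_dominated _ _ _ _ _ _ _ _
      (fun w => f x w.1 * f x w.1 + 1 * 1) (fun v => 0)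
      (fun v => f x v * f x v + 1 * 1) (K x x + 1)) //=.
    + by rewrite integral0.
    + apply: measurable_funD => //; apply: measurable_funM;
        exact: (measurableT_comp (mf _)).
    + move=> w; have := normr_mul_le_sqr (f x w.1) (s w.2).
      by rewrite !expr2 ss [1 * 1]mulr1.
    + by move=> v; rewrite integral_cst//= probability_setT mule1.
    + apply: (integral_sum_sqr (mf x) (measurable_cst (1 : R)) (fK x x)).
      under eq_integral do rewrite /= mulr1.
      by rewrite integral_cst//= probability_setT mule1.
    + by move=> v; rewrite integral_fair_coin /s; congr EFin; lra.
move=> x y; apply/matrixP => j k; rewrite !ord1 !mxE eqxx mulr1n.
rewrite /complex_expectation !unlock.
have E w : Z x ord0 w * (Z y ord0 w)^*%C =
    (f x w.1 * s w.2 * (f y w.1 * s w.2))%:C%C.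
  by rewrite /Z conjc_real -rmorphM.
under [in X in (X +i* _)%C]eq_integral do rewrite E /=.
under [in X in (_ +i* X)%C]eq_integral do rewrite E /=.
by rewrite integral0 /= PE.
Qed.

End covariance_of_gram.

(** * The Gaussian Fourier formula *)

Section derivatives.
Context {R : realType}.
Implicit Types (a b c x t : R) (u v : R -> R).

Lemma is_derive_quadratic a b c x :
  is_derive x 1 (fun t => a * t ^+ 2 + b * t + c) (2 * a * x + b).
Proof.
have hid := is_derive_id x (1 : R).
have h2 := @is_deriveZ _ _ _ _ a _ _ _ (is_deriveX 2 hid).
have h1 := @is_deriveZ _ _ _ _ b _ _ _ hid.
rewrite (_ : (fun t => _) = a \*: (@id R ^+ 2) + b \*: (@id R) + cst c :> (R -> R)); last first.
  by apply/funext => t; rewrite /= expr2.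
have h12 := is_deriveD h2 h1.
have h := is_deriveD h12 (is_derive_cst c x 1).
apply: is_derive_eq h _.
by rewrite /GRing.scale /= /GRing.scale/= expr1; ring.
Qed.

Lemma is_derive_expR_cos u v (u' v' : R) x :
  is_derive x 1 u u' -> is_derive x 1 v v' ->
  is_derive x 1 (fun t => expR (u t) * cos (v t))
    (expR (u x) * (u' * cos (v x) - v' * sin (v x))).
Proof.
move=> hu hv.
have hE := is_derive1_comp (is_derive_expR (u x)) hu.
have hC := is_derive1_comp (is_derive_cos (v x)) hv.
apply: is_derive_eq (is_deriveM hE hC) _.
by rewrite /GRing.scale /=; ring.
Qed.

Lemma is_derive_expR_sin u v (u' v' : R) x :
  is_derive x 1 u u' -> is_derive x 1 v v' ->
  is_derive x 1 (fun t => expR (u t) * sin (v t))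
    (expR (u x) * (u' * sin (v x) + v' * cos (v x))).
Proof.
move=> hu hv.
have hE := is_derive1_comp (is_derive_expR (u x)) hu.
have hC := is_derive1_comp (is_derive_sin (v x)) hv.
apply: is_derive_eq (is_deriveM hE hC) _.
by rewrite /GRing.scale /=; ring.
Qed.

(** The fundamental theorem of calculus on growing symmetric intervals, then dominated convergence
    with majorant [|h'|]. *)
Lemma integral_derivative_eq0 (h h' : R -> R) :
  (forall t, is_derive t 1 h (h' t)) -> continuous h' ->
  lebesgue_measure.-integrable setT (EFin \o h') ->
  h n%:R @[n --> \oo] --> 0 -> h (- n%:R) @[n --> \oo] --> 0 ->
  (\int[lebesgue_measure]_t (h' t)%:E)%E = 0%E.
Proof.
move=> dh ch' ih' hp hn.
have mh' : measurable_fun setT h' by exact: continuous_measurable_fun.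
(* The successor keeps the interval nondegenerate at [n = 0], as [continuous_FTC2] requires. *)
pose D n : set R := `[- n.+1%:R, n.+1%:R].
pose f_ n (t : R) := ((h' \_ (D n)) t)%:E.
have mf_ n : measurable_fun setT (f_ n).
  have mD : measurable (D n) by exact: measurable_itv.
  by apply/measurable_EFinP; apply/(measurable_restrictT h' mD)/measurable_funTS.
have mf : measurable_fun setT (EFin \o h') by exact/measurable_EFinP.
have f_f : {ae lebesgue_measure, forall t : R, setT t ->
    f_ ^~ t @ \oo --> (EFin \o h') t}.
  apply: aeW => t _; apply: cvg_near_cst.
  exists (Num.truncn `|t|) => // n /= tn; rewrite /f_ patchE mem_set//=.
  rewrite /D /= in_itv /= -ler_norml ltW//.
  by rewrite (lt_le_trans (truncnS_gt _))// ler_nat ltnS.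
have f_g : {ae lebesgue_measure, forall (t : R) n, setT t ->
    (`|f_ n t| <= (abse \o (EFin \o h')) t)%E}.
  apply: aeW => t n _ /=; rewrite lee_fin patchE.
  by case: ifP => // _; rewrite normr0.
have [_ _] := @dominated_convergence _ (measurableTypeR R) R
  (@lebesgue_measure R) setT measurableT f_ (EFin \o h')
  (abse \o (EFin \o h')) mf_ mf f_f (integrable_abse ih') f_g.
have E n : (\int[lebesgue_measure]_t f_ n t =
    (h n.+1%:R)%:E - (h (- n.+1%:R))%:E)%E.
  transitivity (\int[lebesgue_measure]_(t in D n) (h' t)%:E)%E.
    rewrite [RHS]integral_mkcond; apply: eq_integral => t _.
    by rewrite /f_ !patchE; case: ifP.
  rewrite (@continuous_FTC2 _ _ h)//.
  - by rewrite -subr_gt0 opprK addr_gt0.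
  - exact: continuous_subspaceT.
  - have ch t : {for t, continuous h}.
      by apply/differentiable_continuous/derivable1_diffP; have [] := dh t.
    split.
    + by move=> t _; have [] := dh t.
    + exact/cvg_at_right_filter/ch.
    + exact/cvg_at_left_filter/ch.
  - by move=> t _; rewrite derive1E; have [_ ->] := dh t.
rewrite (eq_cvg _ _ E) => cv.
have cv0 : ((h n.+1%:R)%:E - (h (- n.+1%:R))%:E)%E @[n --> \oo] --> 0%E.
  have hcv : (h n.+1%:R - h (- n.+1%:R)) @[n --> \oo] --> (0 : R).
    rewrite -[X in _ --> X](subr0 0); apply: cvgB.
      by rewrite (cvg_shiftS (fun n => h n%:R)).
    by rewrite (cvg_shiftS (fun n => h (- n%:R))).
  by apply: cvg_EFin; [exact: nearW|exact: hcv].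
exact: cvg_unique cv cv0.
Qed.

End derivatives.

(** * One-dimensional Gaussian integrals with a cosine *)

Section gaussian_cosine.
Context {R : realType}.
Let mu := @lebesgue_measure R.
Implicit Types s b c e t : R.

Lemma measurable_gauss_quadratic s b :
  measurable_fun setT (fun t => expR (- (s * (t + b) ^+ 2))).
Proof.
apply: measurableT_comp => //; apply: measurableT_comp => //.
apply: measurable_funM => //; apply: measurable_funX.
exact: measurable_funD.
Qed.

Lemma integral_gauss_quadratic s b : 0 < s ->
  (\int[mu]_t (expR (- (s * (t + b) ^+ 2)))%:E)%E = (Num.sqrt (pi / s))%:E.
Proof.
(* The integrand is a multiple of the normal density with mean [- b] and variance [1 / (2 s)]. *)
move=> s0; pose sd := Num.sqrt (2 * s)^-1.
have sd2 : sd ^+ 2 = (2 * s)^-1 by rewrite sqr_sqrtr// invr_ge0; lra.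
have sd0 : sd != 0 by rewrite gt_eqF// sqrtr_gt0 invr_gt0; lra.
have := integral_normal_pdf (- b) sd.
have peak : normal_peak sd = (Num.sqrt (pi / s))^-1.
  by rewrite /normal_peak sd2 -mulr_natr; congr (Num.sqrt _)^-1; field; lra.
have sp : Num.sqrt (pi / s) != 0.
  by rewrite gt_eqF// sqrtr_gt0 divr_gt0// pi_gt0.
have E t : expR (- (s * (t + b) ^+ 2)) =
    Num.sqrt (pi / s) * normal_pdf (- b) sd t.
  rewrite normal_pdfE// peak [RHS]mulrA divff// mul1r /normal_fun sd2.
  by congr expR; rewrite opprK -mulr_natr; field; lra.
under [X in _ -> X = _]eq_integral do rewrite E EFinM.
move=> h; rewrite integralZl//=; last exact: integrable_normal_pdf.
by rewrite h mule1.
Qed.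

Lemma integrable_gauss_quadratic s b : 0 < s ->
  mu.-integrable setT (fun t => (expR (- (s * (t + b) ^+ 2)))%:E).
Proof.
move=> s0; apply: integrable_of_integral_ge0 (integral_gauss_quadratic b s0).
  exact: measurable_gauss_quadratic.
by move=> t; exact: expR_ge0.
Qed.

Section fixed_parameters.
Variables s b c : R.
Hypothesis s0 : 0 < s.

Let u e t := s * e ^+ 2 - s * (t + b) ^+ 2.
Let v e t := 2 * s * (t + b) * e + c.
Let f e t := expR (u e t) * cos (v e t).
Let h e t := expR (u e t) * sin (v e t).
(* [f'] is at once the derivative of [f] in [e] and of [h] in [t]: up to a
   phase, [f] and [h] are the real and imaginary parts of
   [exp(- s (t + b - i e)^2)], and this is a Cauchy-Riemann equation. *)
Let f' e t := 2 * s * expR (u e t) * (e * cos (v e t) - (t + b) * sin (v e t)).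

Let is_derive_f e t : is_derive e 1 (f ^~ t) (f' e t).
Proof.
have hu : is_derive e 1 (u ^~ t) (2 * s * e).
  have := is_derive_quadratic s 0 (- (s * (t + b) ^+ 2)) e.
  rewrite addr0 (_ : (fun x => _) = u ^~ t)//.
  by apply/funext => x; rewrite mul0r addr0.
have hv : is_derive e 1 (v ^~ t) (2 * s * (t + b)).
  have := is_derive_quadratic 0 (2 * s * (t + b)) c e.
  rewrite mulr0 mul0r add0r (_ : (fun x => _) = v ^~ t)//.
  by apply/funext => x; rewrite mul0r add0r.
apply: is_derive_eq (is_derive_expR_cos hu hv) _.
by rewrite /f'; ring.
Qed.

Let is_derive_h e t : is_derive t 1 (h e) (f' e t).
Proof.
have hu : is_derive t 1 (u e) (- (2 * s * (t + b))).
  have := is_derive_quadratic (- s) (- (2 * s * b)) (s * e ^+ 2 - s * b ^+ 2) t.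
  rewrite (_ : (fun x => _) = u e); last by apply/funext => x; rewrite /u; ring.
  by move=> /is_derive_eq; apply; ring.
have hv : is_derive t 1 (v e) (2 * s * e).
  have := is_derive_quadratic 0 (2 * s * e) (2 * s * b * e + c) t.
  rewrite (_ : (fun x => _) = v e); last by apply/funext => x; rewrite /v; ring.
  by move=> /is_derive_eq; apply; ring.
apply: is_derive_eq (is_derive_expR_sin hu hv) _.
by rewrite /f'; ring.
Qed.

Let cu e : continuous (u e).
Proof.
have D t : is_derive t 1 (u e) (- s * 2 * t - 2 * s * b).
  have := is_derive_quadratic (- s) (- (2 * s * b)) (s * e ^+ 2 - s * b ^+ 2) t.
  rewrite (_ : (fun x => _) = u e); last by apply/funext => x; rewrite /u; ring.
  by move=> /is_derive_eq; apply; ring.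
by move=> t; apply/differentiable_continuous/derivable1_diffP; have [] := D t.
Qed.

Let cv e : continuous (v e).
Proof.
have D t : is_derive t 1 (v e) (2 * s * e).
  have := is_derive_quadratic 0 (2 * s * e) (2 * s * b * e + c) t.
  rewrite (_ : (fun x => _) = v e); last by apply/funext => x; rewrite /v; ring.
  by move=> /is_derive_eq; apply; ring.
by move=> t; apply/differentiable_continuous/derivable1_diffP; have [] := D t.
Qed.

Let cf' e : continuous (f' e).
Proof.
move=> t; rewrite /f'.
have cE : {for t, continuous (fun t => expR (u e t))}.
  by apply: continuous_comp; [exact: cu|exact: continuous_expR].
have cC : {for t, continuous (fun t => cos (v e t))}.
  by apply: continuous_comp; [exact: cv|exact: continuous_cos].
have cS : {for t, continuous (fun t => sin (v e t))}.
  by apply: continuous_comp; [exact: cv|exact: continuous_sin].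
apply: cvgM; first by apply: cvgM => //; exact: cvg_cst.
apply: cvgB; first by apply: cvgM => //; exact: cvg_cst.
by apply: cvgM => //; apply: cvgD; [exact: cvg_id|exact: cvg_cst].
Qed.

Let fE e t : f e t = expR (s * e ^+ 2) * (expR (- (s * (t + b) ^+ 2)) * cos (v e t)).
Proof. by rewrite /f /u expRD mulrA. Qed.

Let measurable_f e : measurable_fun setT (f e).
Proof.
apply: measurable_funM; apply: continuous_measurable_fun => t.
  by apply: continuous_comp; [exact: cu|exact: continuous_expR].
by apply: continuous_comp; [exact: cv|exact: continuous_cos].
Qed.

Let norm_cos_le1 x : `|cos x : R| <= 1.
Proof. by rewrite ler_norml cos_geN1 cos_le1. Qed.

Let norm_sin_le1 x : `|sin x : R| <= 1.
Proof. by rewrite ler_norml sin_geN1 sin_le1. Qed.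

Let integrable_f e : mu.-integrable setT (EFin \o f e).
Proof.
apply: (@le_integrableR _ _ (measurableTypeR R) mu _ (fun t => expR (s * e ^+ 2) * expR (- (s * (t + b) ^+ 2)))).
- exact: measurable_f.
- move=> t; rewrite /f normrM ger0_norm ?expR_ge0// -expRD.
  by rewrite -[leRHS]mulr1 ler_wpM2l// expR_ge0.
- have := integrableZl measurableT (expR (s * e ^+ 2))
    (integrable_gauss_quadratic b s0).
  by apply: eq_integrable.
Qed.

(** An integrable majorant of [f' e], uniform in [|e| <= B]: half of the Gaussian decay is spent on
    the factor linear in [t]. *)
Let bound B t := 2 * s * expR (s * B ^+ 2) * (B + 1) * expR (2 * s)^-1 *
  expR (- (s / 2 * (t + b) ^+ 2)).

Let integrable_bound B : mu.-integrable setT (EFin \o bound B).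
Proof.
have s20 : 0 < s / 2 by rewrite divr_gt0.
have := integrableZl measurableT
  (2 * s * expR (s * B ^+ 2) * (B + 1) * expR (2 * s)^-1)
  (integrable_gauss_quadratic b s20).
by apply: eq_integrable.
Qed.

Let f'_bound B e t : `|e| <= B -> `|f' e t| <= bound B t.
Proof.
move=> eB; have B0 : 0 <= B by rewrite (le_trans _ eB).
rewrite /f' /bound /u; set x := t + b.
have sB : s * e ^+ 2 <= s * B ^+ 2.
  by rewrite ler_pM2l// -[e ^+ 2]real_normK ?num_real// ler_sqr ?nnegrE.
(* The difference of the two sides is [(s |x| - 1) ^ 2 / (2 s)]. *)
have hx : `|x| <= (2 * s)^-1 + s / 2 * x ^+ 2.
  have : 0 <= (s * `|x| - 1) ^+ 2 by exact: sqr_ge0.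
  rewrite -[x ^+ 2]real_normK ?num_real//.
  move=> hh; rewrite -subr_ge0.
  have -> : (2 * s)^-1 + s / 2 * `|x| ^+ 2 - `|x| =
    (s * `|x| - 1) ^+ 2 / (2 * s) by field; move: s0; lra.
  by rewrite divr_ge0//; move: s0; lra.
(* Through [B + |x| <= (B + 1) (1 + |x|) <= (B + 1) exp |x|]. *)
have lin : B + `|x| <= (B + 1) * expR ((2 * s)^-1 + s / 2 * x ^+ 2).
  apply: (@le_trans _ _ ((B + 1) * expR `|x|)); last first.
    by rewrite ler_wpM2l ?ler_expR//; move: s0; lra.
  have := expR_ge1Dx `|x|; have := normr_ge0 x.
  by nra.
have s2 : 0 <= 2 * s by move: s0; lra.
rewrite 2!normrM (ger0_norm (expR_ge0 _)) (ger0_norm s2).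
have tri : `|e * cos (v e t) - x * sin (v e t)| <= B + `|x|.
  apply: le_trans (ler_normB _ _) _; rewrite !normrM; apply: lerD.
    by rewrite -[leRHS]mulr1; apply: ler_pM.
  by rewrite -[leRHS]mulr1; apply: ler_pM.
have -> : 2 * s * expR (s * B ^+ 2) * (B + 1) * expR (2 * s)^-1 *
    expR (- (s / 2 * x ^+ 2)) = 2 * s * (expR (s * B ^+ 2 - s * x ^+ 2) *
    ((B + 1) * expR ((2 * s)^-1 + s / 2 * x ^+ 2))).
  have -> : s * B ^+ 2 - s * x ^+ 2 = s * B ^+ 2 + - (s / 2 * x ^+ 2) +
     - (s / 2 * x ^+ 2) by lra.
  rewrite !expRD [in RHS](expRN (s / 2 * x ^+ 2)).
  have := expR_gt0 (s / 2 * x ^+ 2); set y := expR _ => y0.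
  by rewrite expRN -/y; field; rewrite gt_eqF.
rewrite -[X in X <= _]mulrA ler_wpM2l//.
apply: ler_pM => //; rewrite ?expR_ge0//; first by rewrite ler_expR; lra.
by rewrite (le_trans tri).
Qed.

(** Completing the square, [s x ^ 2 >= x - 1 / (4 s)] with [x = |t + b|], so the Gaussian decays at
    least exponentially. *)
Let h_bound e t y : y <= `|t + b| ->
  `|h e t| <= expR (s * e ^+ 2 + (4 * s)^-1) * expR (- y).
Proof.
move=> yt; rewrite /h normrM ger0_norm ?expR_ge0//.
rewrite -[leRHS]mulr1; apply: ler_pM; rewrite ?expR_ge0//.
rewrite -expRD ler_expR /u.
have : 0 <= (2 * s * `|t + b| - 1) ^+ 2 by exact: sqr_ge0.
rewrite -[(t + b) ^+ 2]real_normK ?num_real//; set x := `|t + b| => hh.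
have : 0 <= (2 * s * x - 1) ^+ 2 / (4 * s) by rewrite divr_ge0//; move: s0; lra.
have -> : (2 * s * x - 1) ^+ 2 / (4 * s) = s * x ^+ 2 - x + (4 * s)^-1.
  by field; move: s0; lra.
by move: yt; rewrite -/x; lra.
Qed.

Let h_cvg e (t : nat -> R) : (forall n, n%:R - `|b| <= `|t n + b|) ->
  h e (t n) @[n --> \oo] --> 0.
Proof.
move=> tb; pose C := expR (s * e ^+ 2 + (4 * s)^-1) * expR `|b|.
have hC n : `|h e (t n)| <= C * expR (- n%:R).
  apply: le_trans (h_bound _ (tb n)) _.
  by rewrite /C -[in leRHS]mulrA -[in leRHS](expRD `|b|) opprB.
have C0 : C * expR (- n%:R) @[n --> \oo] --> 0.
  by rewrite -[X in _ --> X](mulr0 C); apply: cvgM; [exact: cvg_cst|exact: cvgn_expR].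
apply: norm_cvg0; apply: (squeeze_cvgr _ (cvg_cst 0) C0).
by apply: nearW => n; rewrite normr_ge0 hC.
Qed.

Let integral_f'_eq0 e : (\int[mu]_t (f' e t)%:E)%E = 0%E.
Proof.
have mf' : measurable_fun setT (f' e) by apply: continuous_measurable_fun; exact: (@cf' e).
apply: (@integral_derivative_eq0 _ (h e)).
- exact: is_derive_h.
- exact: cf'.
- apply: (@le_integrableR _ _ (measurableTypeR R) mu _ (bound `|e|)) => //.
  by move=> t; apply: f'_bound; rewrite lexx.
- apply: (@h_cvg e (fun n => n%:R)) => n.
  by have := ler_norm (n%:R + b); have := ler_norm (- b); rewrite normrN; lra.
- apply: (@h_cvg e (fun n => - n%:R)) => n.
  by have := ler_norm (- (- n%:R + b)); have := ler_norm b; rewrite normrN; lra.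
Qed.

Let F e := (\int[mu]_t f e t)%R.

(** Differentiation under the integral sign gives the integral of [f' e], which is 0 because [f' e]
    is also the derivative of [h e]. The constant [B] bounds [|x|] for [x] in []e - 1, e + 1[]. *)
Let is_derive_F e : is_derive e 1 F 0.
Proof.
have Ie : (`]e - 1, e + 1[ : set R) e by rewrite /= in_itv/=; lra.
pose B := `|e| + 1.
have intf x : (`]e - 1, e + 1[ : set R) x -> mu.-integrable setT (EFin \o f x).
  by move=> _; exact: integrable_f.
have derf x t : (`]e - 1, e + 1[ : set R) x -> [set: R] t ->
    derivable (f ^~ t) x 1.
  by move=> _ _; have [] := is_derive_f x t.
have G_ge0 t : 0 <= bound B t.
  by apply: le_trans (f'_bound t (_ : `|e| <= B)); rewrite /B ?lerDl.
have G_ub x t : (`]e - 1, e + 1[ : set R) x -> [set: R] t ->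
    `|(partial1of2 f) x t| <= bound B t.
  rewrite /= in_itv/= => /andP[ex xe] _; rewrite partial1of2E.
  have [_ ->] := is_derive_f x t; apply: f'_bound.
  have := ler_normD (x - e) e; rewrite subrK => /le_trans; apply.
  by rewrite /B addrC lerD2l ler_norml; lra.
have D1 := derivable_under_integral measurableT Ie intf derf G_ge0
  (integrable_bound B) G_ub.
have D2 := differentiation_under_integral measurableT Ie intf derf G_ge0
  (integrable_bound B) G_ub.
apply: DeriveDef; first exact: D1.
rewrite -derive1E D2 /Rintegral.
rewrite (_ : integral _ _ _ = 0%E)// -(integral_f'_eq0 e).
apply: eq_integral => t _; rewrite partial1of2E.
by have [_ ->] := is_derive_f e t.
Qed.

(** [F] is constant, and at [e = 0] the cosine is the constant [cos c]. The integral sought is [F e]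
    divided by [expR (s * e ^+ 2)]. *)
Lemma integral_gauss_cos e :
  (\int[mu]_t (expR (- (s * (t + b) ^+ 2)) *
     cos (2 * s * (t + b) * e + c))%:E)%E =
  (Num.sqrt (pi / s) * expR (- (s * e ^+ 2)) * cos c)%:E.
Proof.
have F0 : F 0 = Num.sqrt (pi / s) * cos c.
  rewrite /F /Rintegral.
  under eq_integral do rewrite fE /v mulr0 add0r expr0n/= mulr0 expR0 mul1r EFinM.
  rewrite integralZr//=; last exact: integrable_gauss_quadratic.
  by rewrite integral_gauss_quadratic.
have Fe : F e = F 0 by exact: is_derive_0_is_cst.
have : (\int[mu]_t (f e t)%:E)%E = (F e)%:E.
  by rewrite /F /Rintegral fineK//; exact: (integrable_fin_num measurableT (integrable_f e)).
rewrite Fe F0.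
under eq_integral do rewrite fE EFinM.
rewrite integralZl//=; last first.
  apply: (@le_integrableR _ _ (measurableTypeR R) mu (fun t => expR (- (s * (t + b) ^+ 2)) * cos (v e t))
    (fun t => expR (- (s * (t + b) ^+ 2)))).
  - apply: measurable_funM; first exact: measurable_gauss_quadratic.
    apply: continuous_measurable_fun => t.
    by apply: continuous_comp; [exact: cv|exact: continuous_cos].
  - move=> t; rewrite normrM ger0_norm ?expR_ge0//.
    by rewrite -[leRHS]mulr1 ler_wpM2l// expR_ge0.
  - exact: integrable_gauss_quadratic.
move=> hE; rewrite -[LHS]mul1e -[1%E](_ : (expR (- (s * e ^+ 2)) * expR (s * e ^+ 2))%:E = 1%E).
  by rewrite EFinM -muleA hE -EFinM; congr EFin; ring.
by rewrite -expRD addNr expR0.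
Qed.

End fixed_parameters.

End gaussian_cosine.

Section gaussian_weight.
Context {R : realType}.
Let mu := @lebesgue_measure R.

(** The Radon-Nikodym derivative and [normal_pdf] have the same integral over every measurable set,
    so they agree almost everywhere. *)
Lemma ge0_integral_normal_prob (m s : R) (f : R -> \bar R) :
  measurable_fun setT f -> (forall x, 0 <= f x)%E ->
  (\int[normal_prob m s]_x f x = \int[mu]_x (f x * (normal_pdf m s x)%:E))%E.
Proof.
move=> mf f0; have numu := @normal_prob_dominates R m s.
rewrite -(Radon_Nikodym_SigmaFinite.change_of_variables numu)//.
have mpdf : measurable_fun setT (fun x => (normal_pdf m s x)%:E).
  by apply/measurable_EFinP; exact: measurable_normal_pdf.
have mRN : measurable_fun setT
    (Radon_Nikodym_SigmaFinite.f (normal_prob m s) lebesgue_measure).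
  exact: measurable_int (Radon_Nikodym_SigmaFinite.f_integrable numu).
apply: ae_eq_integral => //.
- exact: emeasurable_funM.
- exact: emeasurable_funM.
- apply: ae_eqe_mul2l; apply: integral_ae_eq => //.
    exact: Radon_Nikodym_SigmaFinite.f_integrable.
  by move=> E _ mE; rewrite -Radon_Nikodym_SigmaFinite.f_integral.
Qed.

(* [w] is a multiple of the inverse of the density of [Q], so that integrating
   against [w] and [Q] is integrating against a multiple of Lebesgue measure. *)
Lemma gaussian_weight : exists (Q : probability (measurableTypeR R) R) (w : R -> R),
  [/\ measurable_fun setT w, (forall t, 0 <= w t) & forall s b c e, 0 < s ->
  (\int[Q]_t (w t * (expR (- (s * (t + b) ^+ 2)) *
     cos (2 * s * (t + b) * e + c)))%:E)%E =
  ((Num.sqrt s)^-1 * expR (- (s * e ^+ 2)) * cos c)%:E].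
Proof.
pose p := @normal_pdf R 0 1.
have mp : measurable_fun setT p by exact: measurable_normal_pdf.
have p0 t : 0 < p t.
  by rewrite /p normal_pdfE ?oner_neq0// mulr_gt0 ?expR_gt0// normal_peak_gt0// oner_neq0.
(* The factor [Num.sqrt pi] turns the constant [Num.sqrt (pi / s)] into [(Num.sqrt s)^-1]. *)
pose w t := (Num.sqrt pi * p t)^-1.
have w0 t : 0 <= w t by rewrite invr_ge0 mulr_ge0// ltW.
have mw : measurable_fun setT w.
  apply: continuous_measurable_fun => t; apply: cvgV.
    by rewrite mulf_neq0 ?gt_eqF// sqrtr_gt0 pi_gt0.
  by apply: cvgM; [exact: cvg_cst|exact: continuous_normal_pdf (oner_neq0 R) t].
have wE (g : R -> R) I : measurable_fun setT g -> (forall t, 0 <= g t) ->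
    (\int[mu]_t (g t)%:E)%E = I%:E ->
    (\int[normal_prob 0 1]_t (w t * g t)%:E)%E = ((Num.sqrt pi)^-1 * I)%:E.
  move=> mg g0 gI.
  rewrite (ge0_integral_normal_prob _ _ (f := fun t => (w t * g t)%:E)).
  - rewrite EFinM -gI -ge0_integralZl//.
    + apply: eq_integral => t _; rewrite -!EFinM; congr EFin.
      by rewrite /w invfM -!mulrA; congr (_ * _); rewrite -/p mulrCA mulVf ?mulr1 ?gt_eqF.
    + exact/measurable_EFinP.
    + by move=> t _; rewrite lee_fin.
  - by apply/measurable_EFinP; exact: measurable_funM.
  - by move=> t; rewrite lee_fin mulr_ge0.
exists (normal_prob 0 1), w; split=> // s b c e s0.
pose G t := expR (- (s * (t + b) ^+ 2)).
pose C t := cos (2 * s * (t + b) * e + c).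
have mG : measurable_fun setT G by exact: measurable_gauss_quadratic.
have mC : measurable_fun setT C.
  apply: (measurableT_comp (f := cos)).
    by apply: continuous_measurable_fun; exact: continuous_cos.
  apply: measurable_funD => //; apply: measurable_funM => //.
  by apply: measurable_funM => //; exact: measurable_funD.
have mGC : measurable_fun setT (fun t => G t * C t) by exact: measurable_funM.
have G0 t : 0 <= G t by exact: expR_ge0.
have C1 t : - 1 <= C t <= 1 by rewrite cos_geN1 cos_le1.
(* [wE] covers nonnegative functions; the signed [G * C] is reached as the difference of [G * C + G]
   and [G]. *)
have GG0 t : 0 <= G t * C t + G t.
  by have /andP[] := C1 t; have := G0 t; nra.
have IG := integral_gauss_quadratic b s0.
have iG := integrable_gauss_quadratic b s0.
have IGC := integral_gauss_cos b c s0 e.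
have iGC : mu.-integrable setT (fun t => (G t * C t)%:E).
  apply: (@le_integrableR _ _ (measurableTypeR R) mu _ G) => // t.
  by rewrite normrM ger0_norm// -[leRHS]mulr1 ler_wpM2l// ler_norml.
have IGG : (\int[mu]_t (G t * C t + G t)%:E)%E =
    (Num.sqrt (pi / s) * expR (- (s * e ^+ 2)) * cos c + Num.sqrt (pi / s))%:E.
  under eq_integral do rewrite EFinD.
  by rewrite integralD//= IGC IG.
have wG := wE _ _ mG G0 IG.
have wGG := wE _ _ (measurable_funD mGC mG) GG0 IGG.
have iwG : (normal_prob (0 : R) 1).-integrable setT (fun t => (w t * G t)%:E).
  apply: integrable_of_integral_ge0 wG; first exact: measurable_funM.
  by move=> t; rewrite mulr_ge0.
have iwGG : (normal_prob (0 : R) 1).-integrable setT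
    (fun t => (w t * (G t * C t + G t))%:E).
  apply: integrable_of_integral_ge0 wGG.
    by apply: measurable_funM => //; exact: measurable_funD.
  by move=> t; apply: mulr_ge0; [exact: w0|exact: GG0].
transitivity (\int[normal_prob 0 1]_t
   ((w t * (G t * C t + G t))%:E - (w t * G t)%:E))%E.
  by apply: eq_integral => t _; rewrite -EFinB; congr EFin; rewrite -/(G t) -/(C t); ring.
rewrite integralB// wG wGG -EFinB; congr EFin.
have -> : Num.sqrt (pi / s) = Num.sqrt pi / Num.sqrt s.
  by rewrite sqrtrM ?pi_ge0// sqrtrV// ltW.
have : Num.sqrt (pi : R) != 0 by rewrite gt_eqF// sqrtr_gt0 pi_gt0.
have : Num.sqrt s != 0 by rewrite gt_eqF// sqrtr_gt0.
by move=> ? ?; field; apply/andP.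
Qed.

End gaussian_weight.

(** * Positive definite forms and Schur complements *)

Section quadratic_forms.
Context {R : realType}.

Definition bilinear_form m (S : 'M[R]_m) (u v : 'cV[R]_m) : R :=
  (u^T *m S *m v) 0 0.

Definition pd_matrix m (S : 'M[R]_m) : Prop :=
  S^T = S /\ forall v : 'cV[R]_m, v != 0 -> 0 < bilinear_form S v v.

Lemma bilinear_formE m (S : 'M[R]_m) u v :
  bilinear_form S u v = \sum_j (\sum_i u i 0 * S i j) * v j 0.
Proof.
rewrite /bilinear_form mxE; apply: eq_bigr => j _; rewrite mxE.
by congr (_ * _); apply: eq_bigr => i _; rewrite mxE.
Qed.

Lemma bilinear_formDl m (S T : 'M[R]_m) u v :
  bilinear_form (S + T) u v = bilinear_form S u v + bilinear_form T u v.
Proof. by rewrite /bilinear_form mulmxDr mulmxDl mxE. Qed.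

Lemma bilinear_formNl m (S : 'M[R]_m) u v :
  bilinear_form (- S) u v = - bilinear_form S u v.
Proof. by rewrite /bilinear_form mulmxN mulNmx mxE. Qed.

Lemma bilinear_formZr m (S : 'M[R]_m) a u v :
  bilinear_form S u (a *: v) = a * bilinear_form S u v.
Proof. by rewrite /bilinear_form -scalemxAr mxE. Qed.

Lemma bilinear_formZl m (S : 'M[R]_m) a u v :
  bilinear_form S (a *: u) v = a * bilinear_form S u v.
Proof. by rewrite /bilinear_form linearZ /= -!scalemxAl mxE. Qed.

Lemma bilinear_form0r m (S : 'M[R]_m) u : bilinear_form S u 0 = 0.
Proof. by rewrite /bilinear_form mulmx0 mxE. Qed.

Lemma measurable_bilinear_form d (T : measurableType d) m (S : 'M[R]_m)
    (u v : T -> 'cV[R]_m) :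
  (forall i, measurable_fun setT (fun t => u t i 0)) ->
  (forall i, measurable_fun setT (fun t => v t i 0)) ->
  measurable_fun setT (fun t => bilinear_form S (u t) (v t)).
Proof.
move=> mu mv.
rewrite (_ : (fun _ => _) =
  (fun t => \sum_j (\sum_i u t i 0 * S i j) * v t j 0)); last first.
  by apply/funext => t; rewrite bilinear_formE.
apply: measurable_sum => j; apply: measurable_funM => //.
by apply: measurable_sum => i; exact: measurable_funM.
Qed.

Lemma pd_matrix_unit m (S : 'M[R]_m) : pd_matrix S -> S \in unitmx.
Proof.
move=> [Ssym Spd]; rewrite -row_free_unit -kermx_eq0; apply/eqP/row_matrixP => i.
rewrite row0; apply/eqP/negPn/negP => ri0.
have := Spd (row i (kermx S))^T; rewrite trmx_eq0 => /(_ ri0).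
rewrite /bilinear_form trmxK -row_mul mulmx_ker row0 mul0mx mxE.
by rewrite ltxx.
Qed.

Section schur_complement.
Variables (m : nat) (S : 'M[R]_(1 + m)).
Hypothesis Spd : pd_matrix S.

Let a := ulsubmx S 0 0.
Let r : 'rV[R]_m := ursubmx S.
Let S' : 'M[R]_m := drsubmx S - a^-1 *: (r^T *m r).
Let rho (u : 'cV[R]_m) : R := a^-1 * (r *m u) 0 0.

Let ula : ulsubmx S = a%:M. Proof. exact: mx11_scalar. Qed.

Let dlE : dlsubmx S = r^T.
Proof. by rewrite /r trmx_ursub Spd.1. Qed.

Let S_block : S = block_mx a%:M r r^T (drsubmx S).
Proof. by rewrite -ula -dlE submxK. Qed.

Lemma schur_pivot_gt0 : 0 < a.
Proof.
have e0 : col_mx (1%:M : 'M[R]_1) (0 : 'cV[R]_m) != 0.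
  by rewrite col_mx_eq0 negb_and oner_neq0.
have := Spd.2 _ e0; rewrite /bilinear_form S_block tr_col_mx mul_row_block.
rewrite mul_row_col trmx1 !mul1mx trmx0 !mul0mx addr0 mulmx0 addr0 mulmx1.
by rewrite mxE eqxx mulr1n.
Qed.

(** Completing the square in the first coordinate: [a] is the pivot, [S'] its Schur complement, and
    [rho] the shift absorbing the mixed terms. *)
Lemma schur_bilinear_form (x y : R) (u v : 'cV[R]_m) :
  bilinear_form S (col_mx x%:M u) (col_mx y%:M v) =
  a * (x + rho u) * (y + rho v) + bilinear_form S' u v.
Proof.
have a0 : a != 0 by rewrite gt_eqF// schur_pivot_gt0.
rewrite /rho; set p := (r *m u) 0 0; set q := (r *m v) 0 0.
have urE : u^T *m r^T = p%:M by rewrite -trmx_mul (mx11_scalar (r *m u)) tr_scalar_mx.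
have rvE : r *m v = q%:M by exact: mx11_scalar.
rewrite /bilinear_form {1}S_block tr_col_mx mul_row_block mul_row_col.
rewrite tr_scalar_mx urE [(x%:M *m r + _) *m v]mulmxDl -[x%:M *m r *m v]mulmxA rvE.
rewrite /S' mulmxBr mulmxBl -scalemxAr -scalemxAl mulmxA -[_ *m r *m v]mulmxA.
rewrite urE rvE; set w := u^T *m drsubmx S *m v.
rewrite -!scalar_mxM -raddfD /= -scalar_mxM scale_scalar_mx.
by rewrite !mxE eqxx !mulr1n; field.
Qed.

(** With first coordinate [- rho u] the completed square vanishes, and the form of [S] reduces to
    that of [S']. *)
Lemma schur_pd : pd_matrix S'.
Proof.
split.
  rewrite /S' linearB /= linearZ /= trmx_mul trmxK; congr (_ - _).
  by rewrite trmx_drsub Spd.1.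
move=> u u0; have := schur_bilinear_form (- rho u) (- rho u) u u.
rewrite addNr !mulr0 add0r => <-; apply: Spd.2.
by rewrite col_mx_eq0 negb_and u0 orbT.
Qed.

(** Block column elimination by a unipotent matrix makes [S] lower block triangular. *)
Lemma schur_det : \det S = a * \det S'.
Proof.
have a0 : a != 0 by rewrite gt_eqF// schur_pivot_gt0.
have -> : a * \det S' = \det (block_mx a%:M 0 r^T S').
  by rewrite det_lblock det_scalar1.
have <- : S *m block_mx 1%:M (- a^-1 *: r) 0 1%:M = block_mx a%:M 0 r^T S'.
  rewrite {1}S_block mulmx_block !mulmx1 !mulmx0 !addr0; congr block_mx.
    by rewrite mul_scalar_mx scalerA mulrN divff// scaleN1r addNr.
  by rewrite -scalemxAr scaleNr addrC.
by rewrite det_mulmx det_ublock !det1 !mulr1.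
Qed.

End schur_complement.

End quadratic_forms.

(** * The Gaussian Fourier formula in dimension [m] *)

Section gaussian_vector.
Context {R : realType}.

(* Induction on [m]: integrating out the first coordinate replaces [S] by its
   Schur complement. *)
Lemma gaussian_vector_weight m :
  exists d (T : measurableType d) (Q : probability T R) (u : T -> 'cV[R]_m)
    (w : T -> R),
  [/\ forall i, measurable_fun setT (fun t => u t i 0),
    measurable_fun setT w, (forall t, 0 <= w t) &
    forall S c, pd_matrix S ->
    (\int[Q]_t (w t * (expR (- bilinear_form S (u t) (u t)) *
       cos (2 * bilinear_form S (u t) c)))%:E)%E =
    ((Num.sqrt (\det S))^-1 * expR (- bilinear_form S c c))%:E].
Proof.
elim: m => [|m [d [T [Q [u [w [mu mw w0 IH]]]]]]].
  (* In dimension 0 the determinant is 1 and both sides equal 1. *)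
  exists _, unit, (\d_ tt : probability unit R), (fun=> 0), (fun=> 1).
  split=> // S c _.
  rewrite integral_dirac//= diracT mul1e det_mx00 sqrtr1 invr1.
  rewrite !bilinear_formE !big_ord0 mulr0 cos0 oppr0 expR0 !mulr1.
  by [].
rewrite -[m.+1]/(1 + m)%N.
have [Q1 [w1 [mw1 w10 Q1E]]] := @gaussian_weight R.
(* The new first coordinate is drawn from [Q1], the others from the induction hypothesis. *)
pose U (z : T * measurableTypeR R) : 'cV[R]_(1 + m) := col_mx (z.2)%:M (u z.1).
exists _, (T * measurableTypeR R)%type, (Q \x Q1)%E, U, (fun z => w z.1 * w1 z.2).
have mU i : measurable_fun setT (fun z => U z i 0).
  rewrite /U; case: (split_ordP i) => j ->.
    under eq_fun do rewrite col_mxEu !mxE.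
    by rewrite ord1 /=; exact: measurable_snd.
  under eq_fun do rewrite col_mxEd.
  exact: (measurableT_comp (mu j)).
have mW : measurable_fun setT (fun z : T * measurableTypeR R => w z.1 * w1 z.2).
  by apply: measurable_funM; [exact: (measurableT_comp mw)|exact: (measurableT_comp mw1)].
have mcos : measurable_fun setT (@cos R).
  by apply: continuous_measurable_fun; exact: continuous_cos.
split=> // [z|S c Spd]; first by rewrite mulr_ge0.
pose a := ulsubmx S 0 0; pose r : 'rV[R]_m := ursubmx S.
pose S' := drsubmx S - a^-1 *: (r^T *m r).
pose rho (v : 'cV[R]_m) := a^-1 * (r *m v) 0 0.
have a0 : 0 < a := schur_pivot_gt0 Spd.
have S'pd : pd_matrix S' := schur_pd Spd.
pose g := usubmx c 0 0; pose c' := dsubmx c.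
have cE : c = col_mx g%:M c' by rewrite -mx11_scalar vsubmxK.
(* The first coordinate of [c] after completing the square. *)
pose e := g + rho c'.
have UU z : bilinear_form S (U z) (U z) =
    a * (z.2 + rho (u z.1)) ^+ 2 + bilinear_form S' (u z.1) (u z.1).
  by rewrite (schur_bilinear_form Spd) -mulrA -expr2.
have Uc z : bilinear_form S (U z) c =
    a * (z.2 + rho (u z.1)) * e + bilinear_form S' (u z.1) c'.
  by rewrite cE (schur_bilinear_form Spd).
have cc : bilinear_form S c c = a * e ^+ 2 + bilinear_form S' c' c'.
  by rewrite cE (schur_bilinear_form Spd) -mulrA -expr2.
pose E t := w t * expR (- bilinear_form S' (u t) (u t)).
have E0 t : 0 <= E t by rewrite mulr_ge0// expR_ge0.
pose s' := Num.sqrt a.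
have IE x : (\int[Q]_t (E t * cos (2 * bilinear_form S' (u t) x))%:E)%E =
    ((Num.sqrt (\det S'))^-1 * expR (- bilinear_form S' x x))%:E.
  by rewrite -IH//; apply: eq_integral => t _; rewrite /E mulrA.
have IE0 := IE 0.
have mE : measurable_fun setT E.
  apply: measurable_funM => //; apply: measurableT_comp => //.
  by apply: measurableT_comp => //; exact: measurable_bilinear_form.
have mEcos x : measurable_fun setT (fun t => E t * cos (2 * bilinear_form S' (u t) x)).
  apply: measurable_funM => //; apply: (measurableT_comp mcos).
  by apply: measurable_funM => //; exact: measurable_bilinear_form.
have iE : Q.-integrable setT (fun t => (E t)%:E).
  apply: (@integrable_of_integral_ge0 _ _ _ _ E
    ((Num.sqrt (\det S'))^-1 * expR (- bilinear_form S' 0 0))) => //.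
  rewrite -IE0; apply: eq_integral => t _.
  by rewrite bilinear_form0r mulr0 cos0 mulr1.
have iEcos x : Q.-integrable setT
    (fun t => (E t * cos (2 * bilinear_form S' (u t) x))%:E).
  apply: (@le_integrableR _ _ _ _ _ E) => // t.
  by rewrite normrM ger0_norm// -[leRHS]mulr1 ler_wpM2l// ler_norml cos_geN1 cos_le1.
(* The first coordinate is the inner variable. Dropping the cosine gives the majorant, whose inner
   integral is [E t / Num.sqrt a]. *)
rewrite (@integral_prod_dominated _ _ _ T (measurableTypeR R) Q Q1
  (fun z => w z.1 * w1 z.2 * (expR (- bilinear_form S (U z) (U z)) *
     cos (2 * bilinear_form S (U z) c)))
  (fun z => w z.1 * w1 z.2 * expR (- bilinear_form S (U z) (U z)))
  (fun t => E t * cos (2 * bilinear_form S' (u t) c') *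
     (s'^-1 * expR (- (a * e ^+ 2))))
  (fun t => E t * s'^-1)
  ((Num.sqrt (\det S'))^-1 * expR (- bilinear_form S' 0 0) * s'^-1)) //=.
- under eq_integral do rewrite EFinM.
  rewrite integralZr// IE -EFinM; congr EFin.
  rewrite (schur_det Spd) -/a -/S' sqrtrM ?(ltW a0)// -/s' cc opprD expRD invfM.
  by ring.
- apply: measurable_funM => //; apply: measurable_funM.
    apply: measurableT_comp => //; apply: measurableT_comp => //.
    exact: measurable_bilinear_form.
  apply: (measurableT_comp mcos); apply: measurable_funM => //.
  exact: measurable_bilinear_form.
- apply: measurable_funM => //.
  apply: measurableT_comp => //; apply: measurableT_comp => //.
  exact: measurable_bilinear_form.
- move=> z; rewrite mulrA normrM ger0_norm; last first.
    by rewrite mulr_ge0 ?expR_ge0// mulr_ge0.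
  rewrite -[leRHS]mulr1 ler_wpM2l//; first by rewrite mulr_ge0 ?expR_ge0// mulr_ge0.
  by rewrite ler_norml cos_geN1 cos_le1.
(* With frequency and phase 0 the cosine in [Q1E] is 1. *)
- move=> t; have := Q1E a (rho (u t)) 0 0 a0.
  rewrite cos0 expr0n /= mulr0 oppr0 expR0 !mulr1 => hQ.
  rewrite EFinM -hQ -ge0_integralZl//; last first.
  + by rewrite lee_fin.
  + by move=> y _; rewrite lee_fin mulr_ge0// mulr_ge0 ?expR_ge0// mulr0 addr0 cos0.
  + apply/measurable_EFinP; apply: measurable_funM => //.
    apply: measurable_funM; first exact: measurable_gauss_quadratic.
    by under eq_fun do rewrite mulr0 addr0 cos0; exact: measurable_cst.
  apply: eq_integral => y _; rewrite -EFinM UU /= opprD expRD; congr EFin.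
  by rewrite mulr0 addr0 cos0 /E; ring.
- under eq_integral do rewrite EFinM.
  rewrite integralZr// EFinM -IE0; congr (_ * _)%E.
  by apply: eq_integral => t _; rewrite bilinear_form0r mulr0 cos0 mulr1.
(* The part of the argument of the cosine coming from the other coordinates is a constant phase in
   the inner integral. *)
- move=> t; have hQ := Q1E a (rho (u t)) (2 * bilinear_form S' (u t) c') e a0.
  rewrite (_ : E t * _ * _ = E t * (s'^-1 * expR (- (a * e ^+ 2)) *
    cos (2 * bilinear_form S' (u t) c'))); last by ring.
  rewrite EFinM -hQ -integralZl//; last first.
    have h0 := Q1E a (rho (u t)) 0 0 a0.
    have mg : measurable_fun setT (fun y : measurableTypeR R => w1 y * (expR (- (a * (y + rho (u t)) ^+ 2)))).
      by apply: measurable_funM => //; exact: measurable_gauss_quadratic.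
    apply: (@le_integrableR _ _ (measurableTypeR R) Q1 _ (fun y => w1 y * (expR (- (a * (y + rho (u t)) ^+ 2))))).
    + apply: measurable_funM => //; apply: measurable_funM.
        exact: measurable_gauss_quadratic.
      apply: (measurableT_comp mcos); apply: measurable_funD => //.
      apply: measurable_funM => //; apply: measurable_funM => //.
      exact: measurable_funD.
    + move=> y; rewrite mulrA normrM ger0_norm ?mulr_ge0 ?expR_ge0//.
      rewrite -[leRHS]mulr1 ler_wpM2l ?mulr_ge0 ?expR_ge0//.
      by rewrite ler_norml cos_geN1 cos_le1.
    + apply: (@integrable_of_integral_ge0 _ _ _ _ _
        (s'^-1 * expR (- (a * 0 ^+ 2)) * cos 0)) => //.
        by move=> y; rewrite mulr_ge0// expR_ge0.
      by rewrite -h0; apply: eq_integral => y _; rewrite mulr0 addr0 cos0 mulr1.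
  apply: eq_integral => y _; rewrite -EFinM UU Uc /= opprD expRD; congr EFin.
  rewrite /E mulrDr !mulrA; ring.
Qed.

End gaussian_vector.

(** * Normal scale mixtures and second order fields *)

Section normal_scale_mixtures.
Context {R : realType}.

(** At [h = 0] the mass of [F] on [[0, +oo[] is [phi 0]. Dividing by it leaves a probability, and
    [b] is the square root of the mixing variable. *)
Lemma normal_scale_mixture_prob (phi : R -> R) : normal_scale_mixture phi ->
  exists d (T : measurableType d) (Q : probability T R) (b : T -> R),
  [/\ measurable_fun setT b, 0 <= phi 0 & forall h, 0 <= h ->
    (\int[Q]_t (phi 0 * expR (- (b t * h) ^+ 2))%:E)%E = (phi h)%:E].
Proof.
move=> [F FE]; pose D : set (measurableTypeR R) := `[0, +oo[.
have mD : measurable D by exact: measurable_itv.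
have mexp (h : R) : measurable_fun setT (fun a : measurableTypeR R => expR (- (a * h ^+ 2))).
  apply: measurableT_comp => //; apply: measurableT_comp => //.
  exact: measurable_funM.
have F0 : F D = (phi 0)%:E.
  rewrite FE// -[LHS]mul1e -integral_cst//; apply: eq_integral => a _.
  by rewrite expr0n mulr0 oppr0 expR0.
have phi0 : 0 <= phi 0 by rewrite -lee_fin -F0.
(* Without mass [F] cannot be normalized, but then [phi] vanishes on [[0, +oo[] and any probability
   serves. *)
have [phi00|phi0_neq0] := eqVneq (phi 0) 0.
  exists _, unit, (\d_ tt : probability unit R), (fun=> 0); split=> // h h0.
  rewrite phi00; under eq_integral do rewrite mul0r.
  rewrite integral0 FE//; symmetry; apply: null_set_integral => //.
    by apply/measurable_EFinP; apply: measurable_funTS; exact: mexp.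
  by rewrite F0 phi00.
pose nu : {measure set (measurableTypeR R) -> \bar R} := mrestr F mD.
have nuT : nu setT = (phi 0)%:E by rewrite /nu /= /mrestr setTI.
(* The normal law is only the default of [mnormalize] for mass zero or infinite, excluded here. *)
pose Q := mnormalize nu (normal_prob 0 1 : probability (measurableTypeR R) R).
have r0 : 0 <= (phi 0)^-1 by rewrite invr_ge0.
have QE A : Q A = mscale (NngNum r0) nu A.
  rewrite /Q /mnormalize /= nuT eqe (negbTE phi0_neq0) /= /mscale /= muleC.
  by [].
exists _, (measurableTypeR R), Q, Num.sqrt; split=> // [|h h0].
  by apply: continuous_measurable_fun; exact: sqrt_continuous.
pose f (a : R) := phi 0 * expR (- (Num.sqrt a * h) ^+ 2).
have mf : measurable_fun setT (fun a : measurableTypeR R => (f a)%:E).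
  apply/measurable_EFinP; apply: measurable_funM => //.
  apply: measurableT_comp => //; apply: measurableT_comp => //.
  apply: measurable_funX; apply: measurable_funM => //.
  by apply: continuous_measurable_fun; exact: sqrt_continuous.
have f0 a : (0 <= (f a)%:E)%E by rewrite lee_fin mulr_ge0// expR_ge0.
transitivity (\int[mscale (NngNum r0) nu]_a (f a)%:E)%E.
  by apply: eq_measure_integral => A _ _; exact: QE.
rewrite ge0_integral_mscale// (ge0_negligible_integral (measurableC mD))//; last first.
  by rewrite /nu /= /mrestr setICl measure0.
rewrite setTD setCK.
transitivity ((phi 0)^-1%:E * \int[F]_(a in D) (f a)%:E)%E.
  congr (_ * _)%E; apply: eq_measure_integral => A mA AD.
  by rewrite /nu /= /mrestr setIidl.
transitivity ((phi 0)^-1%:E *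
   ((phi 0)%:E * \int[F]_(a in D) (expR (- (a * h ^+ 2)))%:E))%E.
  congr (_ * _)%E; rewrite -ge0_integralZl//.
  - apply: eq_integral => a; rewrite inE /D /= in_itv /= andbT => a0.
    by rewrite -EFinM /f exprMn sqr_sqrtr.
  - by apply/measurable_EFinP; apply: measurable_funTS; exact: mexp.
by rewrite -FE// -!EFinM mulrA mulVf// mul1r.
Qed.

End normal_scale_mixtures.

(** * Quadratic forms of covariances and variograms *)

Section gram_of_field.
Context {R : realType}.

Section real_field.
Context dT (T : measurableType dT) (P : probability T R) (X : Type) (m : nat).
Variable A : X -> 'I_m -> T -> R.
Hypothesis mA : forall x j, measurable_fun setT (A x j).
Hypothesis A2 : forall x j, exists a, (\int[P]_t (A x j t * A x j t)%:E)%E = a%:E.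

Definition second_moment (x y : X) : 'M[R]_m :=
  \matrix_(j, k) (\int[P]_t (A x j t * A y k t))%R.

Lemma integrable_fieldM x j y k :
  P.-integrable setT (fun t => (A x j t * A y k t)%:E).
Proof.
have [a ha] := A2 x j; have [b hb] := A2 y k.
exact: (integrableM2 (mA x j) (mA y k) ha hb).
Qed.

Lemma second_momentE x j y k :
  (\int[P]_t (A x j t * A y k t)%:E)%E = (second_moment x y j k)%:E.
Proof.
rewrite mxE /Rintegral fineK//.
exact: (integrable_fin_num measurableT (integrable_fieldM x j y k)).
Qed.

Lemma second_moment_increment x y j k :
  (\int[P]_t ((A x j t - A y j t) * (A x k t - A y k t)))%R =
  second_moment x x j k - second_moment x y j k - second_moment y x j k
    + second_moment y y j k.
Proof.
have E : (\int[P]_t ((A x j t - A y j t) * (A x k t - A y k t))%:E =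
  (second_moment x x j k)%:E - (second_moment x y j k)%:E
    - (second_moment y x j k)%:E + (second_moment y y j k)%:E)%E.
  rewrite -!second_momentE.
  have i1 := integrable_fieldM x j x k; have i2 := integrable_fieldM x j y k.
  have i3 := integrable_fieldM y j x k; have i4 := integrable_fieldM y j y k.
  have i12 := integrableB measurableT i1 i2.
  have i123 := integrableB measurableT i12 i3.
  rewrite -integralB// -integralB// -integralD//.
  apply: eq_integral => t _ /=; rewrite -!EFinB -EFinD; congr EFin; ring.
by rewrite /Rintegral E.
Qed.

(** The kernel is the second moment of the scalar field [u^T A(x)], with [u] as parameter. *)
Lemma gram_family_second_moment dU (U : measurableType dU) (u : U -> 'cV[R]_m) :
  (forall j, measurable_fun setT (fun w => u w j 0)) ->
  gram_family (fun w x y => bilinear_form (second_moment x y) (u w) (u w)).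
Proof.
move=> mu; exists _, T, P, (fun x wt => \sum_j u wt.1 j 0 * A x j wt.2).
split=> [x|w x y].
  apply: measurable_sum => j; apply: measurable_funM.
    exact: (measurableT_comp (mu j)).
  exact: (measurableT_comp (mA x j)).
rewrite /=; under eq_integral do rewrite big_distrlr /= -sumEFin.
have ijk j k : P.-integrable setT
    (fun t => (u w j 0 * A x j t * (u w k 0 * A y k t))%:E).
  have := integrableZl measurableT (u w j 0 * u w k 0) (integrable_fieldM x j y k).
  by apply: eq_integrable => // t _; rewrite -EFinM; congr EFin; ring.
have ij j : P.-integrable setT
    (fun t => (\sum_k u w j 0 * A x j t * (u w k 0 * A y k t))%:E).
  have := @integrable_sum _ _ _ P setT measurableT _ (index_enum 'I_m) xpredT _ (fun k _ => ijk j k).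
  by apply: eq_integrable => // t _; rewrite sumEFin.
rewrite integral_sum// bilinear_formE.
under [X in _ = X%:E]eq_bigr do rewrite mulr_suml.
rewrite exchange_big /= -sumEFin; apply: eq_bigr => j _.
under eq_integral do rewrite -sumEFin.
rewrite integral_sum// -sumEFin; apply: eq_bigr => k _.
transitivity ((u w j 0 * u w k 0)%:E * \int[P]_t (A x j t * A y k t)%:E)%E.
  rewrite -integralZl//; last exact: integrable_fieldM.
  by apply: eq_integral => t _; rewrite -EFinM; congr EFin; ring.
by rewrite second_momentE -EFinM; congr EFin; ring.
Qed.

End real_field.

Lemma bilinear_form_tr m (S : 'M[R]_m) u v :
  bilinear_form S^T u v = bilinear_form S v u.
Proof.
rewrite /bilinear_form.
have -> : u^T *m S^T *m v = (v^T *m S *m u)^T by rewrite !trmx_mul trmxK mulmxA.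
by rewrite [LHS]mxE.
Qed.

Lemma Re_mul_conj (z w : R[i]) :
  complex.Re (z * w^*%C) = complex.Re z * complex.Re w + complex.Im z * complex.Im w.
Proof. by case: z => a b; case: w => c d /=; rewrite mulrN opprK. Qed.

Lemma ReB (z w : R[i]) : complex.Re (z - w) = complex.Re z - complex.Re w.
Proof. by case: z => a b; case: w. Qed.

Lemma ImB (z w : R[i]) : complex.Im (z - w) = complex.Im z - complex.Im w.
Proof. by case: z => a b; case: w. Qed.

Lemma Re_half_mul (z : R[i]) : complex.Re (2^-1 * z) = 2^-1 * complex.Re z.
Proof.
have -> : (2^-1 : R[i]) = (2^-1 : R)%:C%C by rewrite fmorphV rmorph_nat.
by case: z => a b /=; rewrite mul0r subr0.
Qed.

Section complex_field.
Context dT (T : measurableType dT) (P : probability T R) (d m : nat).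
Variable Z : 'cV[R]_d -> 'I_m -> T -> R[i].
Hypothesis hZ : second_order_field P Z.

Let A x j t := complex.Re (Z x j t).
Let B x j t := complex.Im (Z x j t).

Let mA x j : measurable_fun setT (A x j).
Proof. by have [[]] := hZ x j. Qed.

Let mB x j : measurable_fun setT (B x j).
Proof. by have [[]] := hZ x j. Qed.

Let normcE x j t : Normc.normc (Z x j t) ^+ 2 = A x j t * A x j t + B x j t * B x j t.
Proof.
rewrite /A /B; case: (Z x j t) => a b /=.
by rewrite sqr_sqrtr ?addr_ge0 ?sqr_ge0// !expr2.
Qed.

Let L2 (f : T -> R) x j : measurable_fun setT f ->
  (forall t, f t * f t <= A x j t * A x j t + B x j t * B x j t) ->
  exists a, (\int[P]_t (f t * f t)%:E)%E = a%:E.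
Proof.
move=> mf fZ; have [_ + _] := hZ x j; rewrite unlock => Zoo.
suff : (\int[P]_t (f t * f t)%:E)%E \is a fin_num.
  by move=> /fineK <-; eexists.
rewrite ge0_fin_numE; last first.
  by apply: integral_ge0 => t _; rewrite lee_fin -expr2 sqr_ge0.
apply: le_lt_trans Zoo; apply: ge0_le_integral => //.
- by move=> t _; rewrite lee_fin -expr2 sqr_ge0.
- by apply/measurable_EFinP; exact: measurable_funM.
- apply/measurable_EFinP; under eq_fun do rewrite normcE.
  by apply: measurable_funD; exact: measurable_funM.
- by move=> t _; rewrite lee_fin normcE.
Qed.

Let A2 x j : exists a, (\int[P]_t (A x j t * A x j t)%:E)%E = a%:E.
Proof. by apply: (@L2 _ x j) => // t; rewrite lerDl -expr2 sqr_ge0. Qed.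

Let B2 x j : exists a, (\int[P]_t (B x j t * B x j t)%:E)%E = a%:E.
Proof. by apply: (@L2 _ x j) => // t; rewrite lerDr -expr2 sqr_ge0. Qed.

Let S x y := second_moment P A x y + second_moment P B x y.

Let gram_S dU (U : measurableType dU) (u : U -> 'cV[R]_m) :
  (forall j, measurable_fun setT (fun w => u w j 0)) ->
  gram_family (fun w x y => bilinear_form (S x y) (u w) (u w)).
Proof.
move=> mu; apply: eq_gram_family (gram_family_add
  (gram_family_second_moment mA A2 mu) (gram_family_second_moment mB B2 mu)).
by move=> w x y; rewrite bilinear_formDl.
Qed.

Let RintegralAB (f g : T -> R) (h : T -> R) : (forall t, h t = f t + g t) ->
  P.-integrable setT (EFin \o f) -> P.-integrable setT (EFin \o g) ->
  (\int[P]_t h t)%R = (\int[P]_t f t)%R + (\int[P]_t g t)%R.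
Proof.
by move=> hE i1 i2; rewrite -RintegralD//; apply: eq_Rintegral => t _; rewrite hE.
Qed.

Let gram_of_cross_covariance (G : 'cV[R]_d -> 'cV[R]_d -> 'M[R]_m) :
  (forall x y, cplx_mx (- G x y) = field_cross_covariance P Z x y) ->
  forall x y, - G x y = S x y.
Proof.
move=> GE x y; apply/matrixP => j k.
have /matrixP/(_ j k)/(congr1 (@complex.Re R)) := GE x y.
rewrite mxE /field_cross_covariance [X in _ = complex.Re X]mxE /complex_expectation /= => ->.
rewrite unlock -/(Rintegral _ _ _) /S mxE [X in _ = X + _]mxE [X in _ = _ + X]mxE.
apply: RintegralAB.
- by move=> t; rewrite Re_mul_conj.
- exact: (integrable_fieldM mA A2).
- exact: (integrable_fieldM mB B2).
Qed.

Let gram_of_cross_variogram (G : 'cV[R]_d -> 'cV[R]_d -> 'M[R]_m) :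
  (forall x y, cplx_mx (G x y) = field_cross_variogram P Z x y) ->
  forall x y, G x y = 2^-1 *: (S x x - S x y - S y x + S y y).
Proof.
move=> GE x y; apply/matrixP => j k.
have /matrixP/(_ j k)/(congr1 (@complex.Re R)) := GE x y.
rewrite mxE /field_cross_variogram [X in _ = complex.Re X]mxE Re_half_mul.
rewrite /complex_expectation /= => ->.
rewrite unlock -/(Rintegral _ _ _).
have incr (C : 'cV[R]_d -> 'I_m -> T -> R) :
    (forall x j, measurable_fun setT (C x j)) ->
    (forall x j, exists a, (\int[P]_t (C x j t * C x j t)%:E)%E = a%:E) ->
    P.-integrable setT
      (fun t => ((C x j t - C y j t) * (C x k t - C y k t))%:E).
  move=> mC C2.
  have i1 := integrable_fieldM mC C2 x j x k; have i2 := integrable_fieldM mC C2 x j y k.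
  have i3 := integrable_fieldM mC C2 y j x k; have i4 := integrable_fieldM mC C2 y j y k.
  have := integrableD measurableT (integrableB measurableT
    (integrableB measurableT i1 i2) i3) i4.
  by apply: eq_integrable => // t _ /=; rewrite -!EFinB -EFinD; congr EFin; ring.
rewrite (@RintegralAB
  (fun t => (A x j t - A y j t) * (A x k t - A y k t))
  (fun t => (B x j t - B y j t) * (B x k t - B y k t))).
- rewrite (second_moment_increment mA A2) (second_moment_increment mB B2).
  rewrite /S; move: (second_moment _ _) (second_moment _ _) => SA SB.
  by rewrite !mxE; ring.
- by move=> t; rewrite Re_mul_conj !ReB !ImB.
- exact: incr mA A2.
- exact: incr mB B2.
Qed.

(** Expanding the increments, a variogram is half of [S x x - S x y - S y x + S y y]. As [S y x] is
    the transpose of [S x y], both have the same quadratic form, so [K = S] and [c x] is half of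
    [S x x]. For a cross covariance, [K = S] and [c = 0]. *)
Lemma field_quadratic_form (G : 'cV[R]_d -> 'cV[R]_d -> 'M[R]_m) :
  (forall x y, cplx_mx (G x y) = field_cross_variogram P Z x y) \/
  (forall x y, cplx_mx (- G x y) = field_cross_covariance P Z x y) ->
  exists (K : 'cV[R]_d -> 'cV[R]_d -> 'M[R]_m) (c : 'cV[R]_d -> 'M[R]_m),
  (forall dU (U : measurableType dU) (u : U -> 'cV[R]_m),
    (forall j, measurable_fun setT (fun w => u w j 0)) ->
    gram_family (fun w x y => bilinear_form (K x y) (u w) (u w))) /\
  forall x y v, bilinear_form (G x y) v v =
    bilinear_form (c x) v v + bilinear_form (c y) v v - bilinear_form (K x y) v v.
Proof.
case=> [GE|GE].
  exists S, (fun x => 2^-1 *: S x x); split=> // x y v.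
  rewrite (gram_of_cross_variogram GE).
  have Syx : S y x = (S x y)^T.
    apply/matrixP => j k; rewrite !mxE; congr (_ + _);
      by apply: eq_Rintegral => t _; rewrite mulrC.
  have bZ a (W : 'M[R]_m) : bilinear_form (a *: W) v v = a * bilinear_form W v v.
    by rewrite /bilinear_form -scalemxAr -scalemxAl mxE.
  rewrite !bZ !bilinear_formDl !bilinear_formNl Syx bilinear_form_tr.
  by rewrite /S !bilinear_formDl; field.
exists S, (fun=> 0); split=> // x y v.
rewrite -(gram_of_cross_covariance GE) bilinear_formNl opprK.
have -> : bilinear_form 0 v v = 0 by rewrite /bilinear_form mulmx0 mul0mx mxE.
by rewrite !add0r.
Qed.

End complex_field.

End gram_of_field.

(** * Assembling the covariance kernel *)

Section gaussian_mixture_kernels.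
Context {R : realType}.

Let measurable_cos : measurable_fun setT (@cos R).
Proof. by apply: continuous_measurable_fun; exact: continuous_cos. Qed.

Let measurable_sin : measurable_fun setT (@sin R).
Proof. by apply: continuous_measurable_fun; exact: continuous_sin. Qed.

(** The Gaussian formula at the vector [b *: c] yields [exp (- b^2 c^T S c)]; integrating over [b]
    yields [phi] at the square root of [c^T S c]. *)
Lemma normal_scale_mixture_fourier (phi : R -> R) m : normal_scale_mixture phi ->
  exists d (T : measurableType d) (Q : probability T R) (u : T -> 'cV[R]_m)
    (b w : T -> R),
  [/\ forall i, measurable_fun setT (fun t => u t i 0), measurable_fun setT b,
    measurable_fun setT w, (forall t, 0 <= w t) &
    forall S c, pd_matrix S ->
    (\int[Q]_t (w t * (expR (- bilinear_form S (u t) (u t)) *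
       cos (2 * (b t * bilinear_form S (u t) c))))%:E)%E =
    (phi (Num.sqrt (bilinear_form S c c)) / Num.sqrt (\det S))%:E].
Proof.
move=> /normal_scale_mixture_prob[d1 [T1 [Q1 [b [mb phi0 phiE]]]]].
have [d2 [T2 [Q2 [u [w [mu mw w0 uE]]]]]] := @gaussian_vector_weight R m.
have mu2 i : measurable_fun setT (fun z : T1 * T2 => u z.2 i 0).
  exact: (measurableT_comp (mu i)).
have mW : measurable_fun setT (fun z : T1 * T2 => phi 0 * w z.2).
  by apply: measurable_funM => //; exact: (measurableT_comp mw).
exists _, (T1 * T2)%type, (Q1 \x Q2)%E, (fun z => u z.2), (fun z => b z.1),
  (fun z => phi 0 * w z.2); split=> //.
- exact: (measurableT_comp mb).
- by move=> z; rewrite mulr_ge0.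
move=> S c Spd; set s := (Num.sqrt (\det S))^-1.
have Sc0 : 0 <= bilinear_form S c c.
  have [->|c0] := eqVneq c 0; first by rewrite bilinear_form0r.
  exact/ltW/(Spd.2 _ c0).
have mg : measurable_fun setT (fun t => w t * expR (- bilinear_form S (u t) (u t))).
  apply: measurable_funM => //; apply: measurableT_comp => //.
  by apply: measurableT_comp => //; exact: measurable_bilinear_form.
have g0 t : 0 <= w t * expR (- bilinear_form S (u t) (u t)).
  by rewrite mulr_ge0// expR_ge0.
(* The case [c = 0], where the cosine is 1, integrates the majorant. *)
have Ig : (\int[Q2]_t (w t * expR (- bilinear_form S (u t) (u t)))%:E)%E = s%:E.
  have := uE S 0 Spd; rewrite bilinear_form0r oppr0 expR0 mulr1 => <-.
  by apply: eq_integral => t _; rewrite bilinear_form0r mulr0 cos0 mulr1.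
have ig := integrable_of_integral_ge0 mg g0 Ig.
have If a : (\int[Q2]_t (w t * (expR (- bilinear_form S (u t) (u t)) *
       cos (2 * (b a * bilinear_form S (u t) c))))%:E)%E =
     (s * expR (- (b a * Num.sqrt (bilinear_form S c c)) ^+ 2))%:E.
  rewrite exprMn sqr_sqrtr//.
  have := uE S (b a *: c) Spd; rewrite bilinear_formZl bilinear_formZr mulrA -expr2 => <-.
  by apply: eq_integral => t _; rewrite bilinear_formZr.
have cos1 x : `|cos x : R| <= 1 by rewrite ler_norml cos_geN1 cos_le1.
have mcosb a : measurable_fun setT (fun t =>
    cos (2 * (b a * bilinear_form S (u t) c))).
  apply: (measurableT_comp measurable_cos); apply: measurable_funM => //.
  by apply: measurable_funM => //; exact: measurable_bilinear_form.
rewrite (@integral_prod_dominated _ _ _ T1 T2 Q1 Q2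
  (fun z => phi 0 * w z.2 * (expR (- bilinear_form S (u z.2) (u z.2)) *
       cos (2 * (b z.1 * bilinear_form S (u z.2) c))))
  (fun z => phi 0 * (w z.2 * expR (- bilinear_form S (u z.2) (u z.2))))
  (fun a => phi 0 * expR (- (b a * Num.sqrt (bilinear_form S c c)) ^+ 2) * s)
  (fun=> phi 0 * s) (phi 0 * s)).
- under eq_integral do rewrite EFinM.
  rewrite integralZr//; first by rewrite phiE ?sqrtr_ge0// -EFinM.
  apply: (@integrable_of_integral_ge0 _ _ _ _ _
     (phi (Num.sqrt (bilinear_form S c c)))).
  + apply: measurable_funM => //; apply: measurableT_comp => //.
    apply: measurableT_comp => //; apply: measurable_funX.
    exact: measurable_funM.
  + by move=> t; rewrite mulr_ge0// expR_ge0.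
  + by rewrite phiE ?sqrtr_ge0.
- apply: measurable_funM => //; apply: measurable_funM.
    apply: measurableT_comp => //; apply: measurableT_comp => //.
    exact: measurable_bilinear_form.
  apply: (measurableT_comp measurable_cos); apply: measurable_funM => //.
  apply: measurable_funM; first exact: (measurableT_comp mb).
  exact: measurable_bilinear_form.
- by apply: measurable_funM => //; exact: (measurableT_comp mg).
- move=> z; rewrite mulrA normrM ger0_norm.
    by rewrite -mulrA -[leRHS]mulr1 ler_wpM2l// mulr_ge0.
  by rewrite mulr_ge0 ?expR_ge0// mulr_ge0.
- by move=> a; under eq_integral do rewrite EFinM; rewrite integralZl// Ig.
- by rewrite integral_cst//= probability_setT mule1.
- move=> a; rewrite -mulrA [_ * s]mulrC EFinM -If -integralZl//.
    by apply: eq_integral => t _; rewrite -EFinM /= -mulrA.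
  apply: (@le_integrableR _ _ _ _ (fun t => w t *
    (expR (- bilinear_form S (u t) (u t)) *
     cos (2 * (b a * bilinear_form S (u t) c)))) _ _ _ ig).
    apply: measurable_funM => //; apply: measurable_funM => //.
    apply: measurableT_comp => //; apply: measurableT_comp => //.
    exact: measurable_bilinear_form.
  move=> t; rewrite mulrA normrM ger0_norm//.
  by rewrite -[leRHS]mulr1 ler_wpM2l.
Qed.

Lemma pd_matrix_of_strict_posdef m (S : 'M[R]_m) :
  strict_posdef (cplx_mx S) -> pd_matrix S.
Proof.
move=> [hS Spd]; split.
  apply/matrixP => i j; move/is_hermitianmxP: (hS) => /matrixP/(_ j i).
  rewrite !mxE expr0 mul1r => /(congr1 (@complex.Re R)) /=.
  by [].
move=> v v0; have cv0 : cplx_mx v != 0.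
  by rewrite map_mx_eq0.
have := Spd _ cv0; rewrite /hermitian_form.
have -> : map_mx Num.conj (cplx_mx v) = cplx_mx v.
  by apply/matrixP => i j; rewrite !mxE; apply/CrealP; rewrite complex_real.
by rewrite /cplx_mx map_trmx -!map_mxM mxE ltcR.
Qed.

Lemma covariance_function_kernel m d (H : 'cV[R]_d -> 'cV[R]_m) (phi : R -> R)
    (G K : 'cV[R]_d -> 'cV[R]_d -> 'M[R]_m) (c : 'cV[R]_d -> 'M[R]_m)
    (M : 'M[R]_m) :
  normal_scale_mixture phi ->
  (forall x y, pd_matrix (M + G x y)) ->
  (forall dU (U : measurableType dU) (u : U -> 'cV[R]_m),
    (forall j, measurable_fun setT (fun w => u w j 0)) ->
    gram_family (fun w x y => bilinear_form (K x y) (u w) (u w))) ->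
  (forall x y v, bilinear_form (G x y) v v =
    bilinear_form (c x) v v + bilinear_form (c y) v v - bilinear_form (K x y) v v) ->
  covariance_function (fun x y : 'cV[R]_d =>
    (phi (Num.sqrt (((H x - H y)^T *m invmx (M + G x y) *m (H x - H y)) 0 0))
       / Num.sqrt (\det (M + G x y)))%:C%C).
Proof.
move=> hphi pdS gK GE; apply: covariance_function_of_gram.
have [dT [T [Q [u [b [w [mu mb mw w0 uE]]]]]]] := normal_scale_mixture_fourier m hphi.
(* The form of the identity matrix is the dot product, so the phase is [2 b u^T H(x)]. *)
pose theta x t := 2 * (b t * bilinear_form 1%:M (u t) (H x)).
(* The weight and the form of [M] are shared equally between [x] and [y]. *)
pose rho x t := Num.sqrt (w t) *
  expR (- (2^-1 * bilinear_form M (u t) (u t) + bilinear_form (c x) (u t) (u t))).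
have mtheta x : measurable_fun setT (theta x).
  apply: measurable_funM => //; apply: measurable_funM => //.
  exact: measurable_bilinear_form.
have mrho x : measurable_fun setT (rho x).
  apply: measurable_funM.
    apply: (measurableT_comp _ mw).
    by apply: continuous_measurable_fun; exact: sqrt_continuous.
  apply: measurableT_comp => //; apply: measurableT_comp => //.
  apply: measurable_funD; last exact: measurable_bilinear_form.
  by apply: measurable_funM => //; exact: measurable_bilinear_form.
(* The cosine of [theta x - theta y] is a sum of two rank-one kernels, by the subtraction
   formula. *)
have g1 := @gram_family_rank1 R _ T _ (fun x t => rho x t * cos (theta x t))
  (fun x => measurable_funM (mrho x) (measurableT_comp measurable_cos (mtheta x))).
have g2 := @gram_family_rank1 R _ T _ (fun x t => rho x t * sin (theta x t))
  (fun x => measurable_funM (mrho x) (measurableT_comp measurable_sin (mtheta x))).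
have gk := gram_family_mul (gram_family_add g1 g2) (gram_family_expR (gK _ _ _ mu)).
apply: (gram_family_integral (P := Q) gk) => x y.
set S := M + G x y; have Spd : pd_matrix S by exact: pdS.
have Su := pd_matrix_unit Spd.
(* With this vector, [v^T S v] is the quadratic form of [invmx S] in the statement, while
   [u^T S v = u^T (H x - H y)] no longer involves [S], so the phase separates in [x] and [y]. *)
pose v := invmx S *m (H x - H y).
have Sv : bilinear_form S v v = ((H x - H y)^T *m invmx S *m (H x - H y)) 0 0.
  rewrite /bilinear_form /v trmx_mul trmx_inv Spd.1 -!mulmxA.
  by rewrite (mulmxA S) mulmxV// mul1mx.
have uSv t : b t * bilinear_form S (u t) v =
    b t * bilinear_form 1%:M (u t) (H x) - b t * bilinear_form 1%:M (u t) (H y).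
  rewrite -mulrBr; congr (_ * _).
  rewrite /bilinear_form /v mulmxA -(mulmxA _ S) mulmxV// mulmx1 mulmxBr.
  by rewrite [LHS]mxE [X in _ + X]mxE.
rewrite -Sv -(uE S v Spd); apply: eq_integral => t _; congr EFin.
rewrite uSv mulrBr cosB -/(theta x t) -/(theta y t).
rewrite /S bilinear_formDl GE.
have -> : - (bilinear_form M (u t) (u t) + (bilinear_form (c x) (u t) (u t) +
    bilinear_form (c y) (u t) (u t) - bilinear_form (K x y) (u t) (u t))) =
   - (2^-1 * bilinear_form M (u t) (u t) + bilinear_form (c x) (u t) (u t))
   + - (2^-1 * bilinear_form M (u t) (u t) + bilinear_form (c y) (u t) (u t))
   + bilinear_form (K x y) (u t) (u t) by field.
rewrite !expRD /rho; set ex := expR _; set ey := expR _; set eK := expR _.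
have -> : w t = Num.sqrt (w t) ^+ 2 :> R by rewrite sqr_sqrtr.
rewrite sqrtr_sqr ger0_norm ?sqrtr_ge0//. ring.
Qed.

End gaussian_mixture_kernels.

Local Open Scope complex_scope.

Theorem theorem5 (R : realType) (m d : nat) (hm : (0 < m)%N) (hd : (0 < d)%N)
  (H : 'cV[R]_d -> 'cV[R]_m)
  (phi : R -> R) (hphi : normal_scale_mixture phi)
  (G : 'cV[R]_d -> 'cV[R]_d -> 'M[R]_m)
  (hG : cross_variogram (fun x y => cplx_mx (G x y)) \/
        cross_covariance_function (fun x y => cplx_mx (- G x y)))
  (M : 'M[R]_m) (hM : posdef (cplx_mx M))
  (hMG : forall x y : 'cV[R]_d, strict_posdef (cplx_mx (M + G x y))) :
  covariance_function (fun x y : 'cV[R]_d =>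
    (phi (Num.sqrt (((H x - H y)^T *m invmx (M + G x y) *m (H x - H y)) 0 0))
       / Num.sqrt (\det (M + G x y)))%:C).
Proof.
have pdMG x y : pd_matrix (M + G x y) by exact: pd_matrix_of_strict_posdef.
by case: hG => [] [disp [T [P [Z [hZ GE]]]]];
  [have [K [c [gK Gq]]] := field_quadratic_form hZ (or_introl GE)
  |have [K [c [gK Gq]]] := field_quadratic_form hZ (or_intror GE)];
  exact: covariance_function_kernel gK Gq.
Qed.
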